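(* Let $n \ge 3$ and let $D$ be a semisimple $x$-monotone drawing of $K_n$. Then for every integer $k$ with $0 \le k < n/2 - 1$, \[E_{\le\le k}(D) \ge 3\binom{k+3}{3}.\]
   Context: Drawings as usual (vertices distinct points, edges simple arcs avoiding other vertices, finitely many common points, no touchings, no three edges through a common interior point). $x$-monotone: every edge meets every vertical line at most once and no two vertices share an $x$-coordinate. Semisimple: no two adjacent edges cross; then each triangle is a simple closed curve, oriented counter-clockwise or clockwise. For edge $\{u,v\}$ oriented $u\to v$, vertex $w$ is on its left side if triangle $uvw$ is counter-clockwise and on its right side otherwise. For an edge $e$ let $m(e)$ be the minimum of the numbers of vertices on its two sides; $e$ is an $i$-edge if $m(e)=i$. $E_i(D)$ is the number of $i$-edges, $E_{\le j}(D)=\sum_{i=0}^j E_i(D)$, and $E_{\le\le k}(D)=\sum_{j=0}^k E_{\le j}(D)=\sum_{i=0}^k(k+1-i)E_i(D)$. *)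

(* Defs.v *)
From mathcomp Require Import all_boot all_order all_algebra.
From mathcomp Require Import all_classical all_reals all_analysis.

Set Implicit Arguments.
Unset Strict Implicit.
Unset Printing Implicit Defensive.

Import Order.TTheory GRing.Theory Num.Theory.
Import numFieldNormedType.Exports.

Local Open Scope classical_set_scope.
Local Open Scope ring_scope.

Section Curves.
Context {R : realType}.
Implicit Types (g h : R -> R * R) (A B : set (R * R)) (p : R * R).

(* Curves are parametrized by [0, 1]; values outside [0, 1] are irrelevant. *)
Definition trace g : set (R * R) := g @` `[0, 1].
Definition arc_interior g : set (R * R) := g @` `]0, 1[.

Definition simple_arc g : Prop :=
  {within `[0, 1], continuous g} /\ {in `[0, 1] &, injective g}.

(* phi is a homeomorphism from an open neighbourhood U of p onto the plane,
   with inverse psi, which straightens A and B to the two coordinate axes.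
   If A and B are arcs with finitely many common points and p is interior to
   both, such a chart exists exactly when A passes at p from one side of B to
   the other; it does not exist when A and B only touch at p. *)
Definition proper_crossing A B p : Prop :=
  exists (U : set (R * R)) (phi psi : R * R -> R * R),
    [/\ open U /\ U p,
        {within U, continuous phi} /\ continuous psi,
        (forall q, U q -> psi (phi q) = q) /\
        (forall z, U (psi z) /\ phi (psi z) = z),
        phi p = (0, 0) &
        (forall q, U q -> (A q <-> (phi q).2 = 0)) /\
        (forall q, U q -> (B q <-> (phi q).1 = 0))].

Definition cross_at g h p : Prop :=
  [/\ arc_interior g p, arc_interior h p & proper_crossing (trace g) (trace h) p].

(* The curve g, restricted to [a, b], avoids p and has winding number k around
   p: theta is a continuous choice of the argument of g - p. *)
Definition winding_number g (a b : R) p (k : int) : Prop :=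
  exists theta : R -> R,
    [/\ {within `[a, b], continuous theta},
        (forall t : R, t \in `[a, b] -> exists2 r : R, 0 < r &
           g t = (p.1 + r * cos (theta t), p.2 + r * sin (theta t))) &
        theta b - theta a = k%:~R * (2 * pi)].

End Curves.

(* Edges of K_n are represented by ordered pairs (u, v) with u != v; (u, v) and
   (v, u) are the same edge. *)
Definition distinct_edges n (e f : 'I_n * 'I_n) : bool :=
  (e != f) && (e != (f.2, f.1)).

Record drawing (R : realType) (n : nat) := Drawing {
  pos : 'I_n -> R * R;
  (* edge_arc (u, v) is the edge {u, v} traversed from u to v; the values
     edge_arc (u, u) are irrelevant. *)
  edge_arc : 'I_n * 'I_n -> R -> R * R;
  pos_inj : injective pos;
  edge_simple : forall e : 'I_n * 'I_n, e.1 != e.2 -> simple_arc (edge_arc e);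
  edge_start : forall e : 'I_n * 'I_n, e.1 != e.2 -> edge_arc e 0 = pos e.1;
  edge_end : forall e : 'I_n * 'I_n, e.1 != e.2 -> edge_arc e 1 = pos e.2;
  edge_rev : forall u v : 'I_n, u != v ->
    forall t : R, t \in `[0, 1] -> edge_arc (v, u) t = edge_arc (u, v) (1 - t);
  edge_avoid : forall (e : 'I_n * 'I_n) (w : 'I_n), e.1 != e.2 -> w != e.1 -> w != e.2 ->
    ~ trace (edge_arc e) (pos w);
  edge_finite : forall e f : 'I_n * 'I_n, e.1 != e.2 -> f.1 != f.2 -> distinct_edges e f ->
    finite_set (trace (edge_arc e) `&` trace (edge_arc f));
  edge_no_touching : forall e f : 'I_n * 'I_n, e.1 != e.2 -> f.1 != f.2 ->
    distinct_edges e f ->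
    forall p, arc_interior (edge_arc e) p -> arc_interior (edge_arc f) p ->
      cross_at (edge_arc e) (edge_arc f) p;
  edge_no_triple : forall e f g : 'I_n * 'I_n, e.1 != e.2 -> f.1 != f.2 -> g.1 != g.2 ->
    distinct_edges e f -> distinct_edges e g -> distinct_edges f g ->
    forall p, ~ [/\ arc_interior (edge_arc e) p, arc_interior (edge_arc f) p
                  & arc_interior (edge_arc g) p]
}.

Section Drawings.
Context {R : realType} {n : nat}.
Implicit Types (D : drawing R n) (u v w : 'I_n).

Definition x_monotone D : Prop :=
  (forall e : 'I_n * 'I_n, e.1 != e.2 -> forall p q,
     trace (edge_arc D e) p -> trace (edge_arc D e) q -> p.1 = q.1 -> p = q) /\
  (forall u v, u != v -> (pos D u).1 <> (pos D v).1).

Definition semisimple D : Prop :=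
  forall u v w, u != v -> u != w -> v != w ->
    forall p, ~ cross_at (edge_arc D (u, v)) (edge_arc D (u, w)) p.

(* The closed curve u -> v -> w -> u, parametrized by [0, 3]. *)
Definition triangle D u v w (t : R) : R * R :=
  if t <= 1 then edge_arc D (u, v) t
  else if t <= 2 then edge_arc D (v, w) (t - 1)
  else edge_arc D (w, u) (t - 2).

(* A simple closed curve has winding number 0 around the points outside it, and
   either 1 around all points inside it or -1 around all points inside it; it is
   counter-clockwise in the first case. *)
Definition ccw D u v w : Prop :=
  exists p, winding_number (triangle D u v w) 0 3 p 1.

Definition left_side D u v : {set 'I_n} :=
  [set w | [&& w != u, w != v & `[< ccw D u v w >]]]%SET.

Definition right_side D u v : {set 'I_n} :=
  [set w | [&& w != u, w != v & ~~ `[< ccw D u v w >]]]%SET.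

Definition min_side D u v : nat := minn #|left_side D u v| #|right_side D u v|.

(* Every edge is counted once, oriented from its smaller to its larger label;
   in a semisimple drawing, reversing the orientation exchanges the two sides
   and preserves min_side. *)
Definition E_eq D (i : nat) : nat :=
  #|[set e : 'I_n * 'I_n | (e.1 < e.2)%N && (min_side D e.1 e.2 == i)]%SET|.

Definition E_le D (j : nat) : nat := (\sum_(i < j.+1) E_eq D i)%N.

Definition E_lele D (k : nat) : nat := (\sum_(j < k.+1) E_le D j)%N.

End Drawings.

(* Main.v *)
Require Import Defs.
From mathcomp Require Import all_boot all_order all_algebra.
From mathcomp Require Import all_classical all_reals all_analysis.
From mathcomp Require Import ring lra zify.

(* In an x-monotone semisimple drawing a triangle whose vertices are u, v, w
   from left to right is counter-clockwise exactly when v lies below the edge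
   uw, since it consists of two graphs over the same interval.  Adjacent edges
   do not cross, so the edges from u to the vertices on its right are totally
   ordered from bottom to top, and the orientation of u, v, w compares the edges
   uv and uw in that order; the same holds on the left.  The rest only uses these
   orders.

   Give an edge e the weight K - m(e), or 0 if this is negative; the total weight
   for K = k + 1 is E_{<=<=k}.  To pass from K to K + 1, remove the rightmost
   vertex z.  The edges at z weigh at least 2 C(K + 2, 2), as the i-th edge from
   below at z has i vertices on one side.  Any other edge weighs at least as much
   as it does for K after the removal, and one more if its side avoiding z has at
   most K vertices.  A vertex with c vertices on its left is the left end of at
   least K + 1 - c edges of the latter kind: those among its K + 1 - c lowest
   edges to the right that lie below the edge to z, and those among its K + 1 - c
   highest ones that lie above it.  Summed over c, this gives C(K + 2, 2) more. *)

Set Implicit Arguments.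
Unset Strict Implicit.
Unset Printing Implicit Defensive.

Import Order.TTheory GRing.Theory Num.Theory.
Import numFieldNormedType.Exports.

(** * Sides of edges and triangle orientations, abstractly *)

Section Tournament.
Context {T : finType}.
Implicit Types (r : rel T) (B : {set T}) (u v w : T).

(** A strict linear order on [B] off the diagonal. Only distinct elements are constrained, because
    [r] will be the orientation of triples at a vertex, which is arbitrary on repeated vertices. *)
Definition transitive_tournament r B : Prop :=
  {in B &, forall u v, u != v -> r u v = ~~ r v u} /\
  {in B & &, forall u v w, u != v -> v != w -> u != w ->
     r u v -> r v w -> r u w}.

Definition rank r B u : nat := #|[set w in B | (w != u) && r w u]|.

Lemma rank_lt r B : transitive_tournament r B ->
  {in B &, forall u v, u != v -> r u v -> (rank r B u < rank r B v)%N}.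
Proof.
move=> [tot tr] u v uB vB uv ruv; apply: proper_card; apply/properP; split.
  apply/fintype.subsetP => w; rewrite !inE => /and3P[wB wu rwu]; rewrite wB /=.
  have wv : w != v by apply: contraTneq rwu => ->; rewrite (tot v u) // 1?eq_sym // negbK.
  by rewrite wv (tr w u v).
by exists u; rewrite !inE uB ?uv ?eqxx //=.
Qed.

(** By [rank_lt] the ranks are pairwise distinct, and all are below [#|B|], so they are a
    permutation of [0, ..., #|B| - 1]. *)
Lemma sum_rank r B (F : nat -> nat) : transitive_tournament r B ->
  (\sum_(u in B) F (rank r B u) = \sum_(i < #|B|) F i)%N.
Proof.
move=> tB; have [tot _] := tB.
have inj : {in enum B &, injective (rank r B)}.
  move=> u v; rewrite !mem_enum => uB vB eq_rk; apply/eqP; apply/negPn/negP => uv.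
  have := rank_lt tB uB vB uv; have := rank_lt tB vB uB.
  rewrite eq_sym eq_rk ltnn => /(_ uv) h1 h2; move: (tot u v uB vB uv) h1 h2.
  by case: (r u v) (r v u) => -[] // _ => [_ /(_ isT)|/(_ isT)].
have uniq_rk : uniq (map (rank r B) (enum B)) by rewrite map_inj_in_uniq ?enum_uniq.
have sub_rk : {subset map (rank r B) (enum B) <= iota 0 #|B|}.
  move=> _ /mapP[u uB ->]; rewrite mem_enum in uB; rewrite mem_iota add0n /=.
  apply: proper_card; apply/properP; split.
    by apply/fintype.subsetP => w; rewrite !inE => /andP[].
  by exists u => //; rewrite !inE eqxx andbF.
have [|_ eqi] := uniq_min_size uniq_rk sub_rk.
  by rewrite size_map size_iota -cardE.
rewrite -big_enum -(big_map (rank r B) xpredT F) /= (perm_big (iota 0 #|B|)).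
  by rewrite -{1}(subn0 #|B|) -/(index_iota 0 #|B|) big_mkord.
by apply: uniq_perm; rewrite ?iota_uniq.
Qed.

Lemma sum_le_threshold b c K :
  (\sum_(i < b) (c + i <= K : nat) = minn b (K.+1 - c))%N.
Proof. by elim: b => [|b IH]; rewrite ?big_ord0 ?big_ord_recr /= ?IH; lia. Qed.

(** Each rank below [#|B|] occurs once, and every rank [i] with [c + i <= K] yields an element with
    [g u <= K]. *)
Lemma count_low_rank r B (g : T -> nat) c K : transitive_tournament r B ->
  {in B, forall u, (g u <= c + rank r B u)%N} ->
  (minn #|B| (K.+1 - c) <= \sum_(u in B) (g u <= K : nat))%N.
Proof.
move=> tB le_g; rewrite -sum_le_threshold -(sum_rank (fun i => (c + i <= K : nat)) tB).
by apply: leq_sum => u uB; have := le_g u uB; lia.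
Qed.

End Tournament.

Lemma sum_subn K M : (K <= M)%N -> (\sum_(i < M) (K - i) = 'C(K.+1, 2))%N.
Proof.
elim: K M => [|K IH] [|M] // leKM; first by rewrite big1.
- by rewrite bin_small // big1.
rewrite big_ord_recl /= subn0 binS bin1 -(IH M) // addnC.
by congr addn; apply: eq_bigr => i _; rewrite /bump /=; lia.
Qed.

(** Since [K.*2 <= M], at most one of [i] and [M.-1 - i] is below [K], so the summand is at least
    [(K - i) + (K - (M.-1 - i))]. Reversing the index turns the second part into the first. *)
Lemma sum_sub_minn K M : (K.*2 <= M)%N ->
  ('C(K.+1, 2).*2 <= \sum_(i < M) (K - minn i (M.-1 - i)))%N.
Proof.
move=> leKM; rewrite -addnn -{1}(@sum_subn K M) -?(@sum_subn K M); try lia.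
rewrite [X in (X + _)%N](reindex_inj rev_ord_inj) -big_split /=.
by apply: leq_sum => i _; have := ltn_ord i; lia.
Qed.

(** * Edge weights in a set of points with oriented triples *)

Section Chirotope.
Context {T : finType} {d : Order.disp_t} {O : orderType d}.
(** [x] stands for the abscissa and [L u v w] for [u v w] being counter-clockwise. Then [L u] orders
    the edges at [u] from bottom to top on its right and from top to bottom on its left. *)
Variables (x : T -> O) (L : T -> T -> T -> bool).
Hypothesis x_inj : injective x.
Hypothesis L_cyc : forall u v w, u != v -> u != w -> v != w -> L u v w = L v w u.
Hypothesis L_right : forall u,
  transitive_tournament (L u) [set v | (x u < x v)%O].
Hypothesis L_left : forall u,
  transitive_tournament (L u) [set v | (x v < x u)%O].
Implicit Types (S : {set T}) (u v w : T).

Definition lset S u v : {set T} := [set w in S | [&& w != u, w != v & L u v w]].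
Definition rset S u v : {set T} := [set w in S | [&& w != u, w != v & ~~ L u v w]].

Definition weight S K u v : nat := K - minn #|lset S u v| #|rset S u v|.

Definition total_weight S K : nat :=
  \sum_(u in S) \sum_(v in S | (x u < x v)%O) weight S K u v.

Lemma card_lrset S u v : u \in S -> v \in S -> u != v ->
  (#|lset S u v| + #|rset S u v| + 2 = #|S|)%N.
Proof.
move=> uS vS uv; have -> : 2 = #|[set u; v]| by rewrite cards2 uv.
rewrite -cardsUI [X in (_ + X + _)%N](_ : _ = 0%N); last first.
  by apply: eq_card0 => w; rewrite !inE; case: (L u v w); rewrite ?andbF.
rewrite addn0 -cardsUI [X in (_ + X)%N](_ : _ = 0%N); last first.
  apply: eq_card0 => w; rewrite !inE; apply/negbTE.
  by case: eqP => _; case: eqP => _; rewrite ?andbF.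
rewrite addn0; apply: eq_card => w; rewrite !inE.
case: eqP => [->|_]; first by rewrite uS orbT.
case: eqP => [->|_]; first by rewrite vS orbT.
by case: (w \in S); case: (L u v w).
Qed.

Lemma transitive_tournamentS (r : rel T) (A B : {set T}) :
  A \subset B -> transitive_tournament r B -> transitive_tournament r A.
Proof.
move=> /fintype.subsetP sAB [tot tr]; split => [u v /sAB uB /sAB vB|]; first exact: tot.
by move=> u v w /sAB uB /sAB vB /sAB wB; apply: tr.
Qed.

Lemma transitive_tournamentC (r : rel T) (B : {set T}) :
  transitive_tournament r B -> transitive_tournament (fun u v => r v u) B.
Proof.
move=> [tot tr]; split => [u v uB vB uv|u v w uB vB wB uv vw uw rvu rwv].
  by rewrite tot // 1?eq_sym.
by apply: (tr w v u) => //; rewrite eq_sym.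
Qed.

(** * Removal of the rightmost vertex, here called [n] *)

Section Step.
Variables (S : {set T}) (n : T) (K : nat).
Hypotheses (nS : n \in S) (n_max : {in S, forall v, (x v <= x n)%O}).
Hypothesis SK : (K.+1.*2 < #|S|)%N.
Let S' := S :\ n.

Lemma lt_max u : u \in S' -> (x u < x n)%O.
Proof.
rewrite !inE => /andP[un uS]; rewrite lt_neqAle n_max // andbT.
by apply: contra_neq un; apply: x_inj.
Qed.

Lemma card_S' : #|S| = #|S'|.+1.
Proof. by rewrite (cardsD1 n S) nS. Qed.

(** By cyclicity the left side of the edge from [u] to [n] consists of the vertices before [u] in
    the order [L n], so its size is the rank [i] of [u], and the right side has the other
    [#|S'|.-1 - i] vertices. *)
Lemma weight_at_max :
  ('C(K.+2, 2).*2 <= \sum_(u in S') weight S K.+1 u n)%N.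
Proof.
have SS := card_S'.
have tS' : transitive_tournament (L n) S'.
  apply: transitive_tournamentS (L_left n).
  by apply/fintype.subsetP => u /lt_max; rewrite inE.
have rkE u : u \in S' -> #|lset S u n| = rank (L n) S' u.
  move=> uS'; have un : u != n by move: uS'; rewrite !inE => /andP[].
  apply: eq_card => w; rewrite !inE.
  case: (eqVneq w n) => [->|wn]; first by rewrite !andbF.
  case: (eqVneq w u) => [->|wu]; first by rewrite !andbF.
  by rewrite (L_cyc (u := u)) // eq_sym.
apply: leq_trans (sum_sub_minn (_ : (K.+1.*2 <= #|S'|)%N)) _; first by lia.
rewrite -(sum_rank (fun i => (K.+1 - minn i (#|S'|.-1 - i))%N) tS').
apply: leq_sum => u uS'; rewrite /weight -rkE //.
have : u \in S by move: uS'; rewrite inE => /andP[].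
have un : u != n by move: uS'; rewrite !inE => /andP[].
move=> uS; have := card_lrset uS nS un; lia.
Qed.

(** The tested side is the one that avoids [n], hence the same set in [S] and in [S']. *)
Definition invariant u v : bool :=
  if L u v n then (#|rset S' u v| <= K)%N else (#|lset S' u v| <= K)%N.

(** Adding [n] enlarges one side by one, so the minimum grows by at most one, as does the threshold.
    If the other side has at most [K] vertices, [SK] makes the side of [n] at least as large already
    in [S']; then the minimum stays and the weight gains one. *)
Lemma weight_invariant u v : u \in S' -> v \in S' -> u != v ->
  (weight S' K u v + invariant u v <= weight S K.+1 u v)%N.
Proof.
move=> uS' vS' uv; have := card_lrset uS' vS' uv; have := card_S'.
have [un uS] : u != n /\ u \in S by move: uS'; rewrite !inE => /andP[].
have [vn vS] : v != n /\ v \in S by move: vS'; rewrite !inE => /andP[].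
have := card_lrset uS vS uv.
have := cardsD1 n (lset S u v); have := cardsD1 n (rset S u v).
rewrite !inE nS ![n == _]eq_sym un vn /= /weight /invariant.
have -> : lset S u v :\ n = lset S' u v.
  by apply/setP => w; rewrite !inE andbA.
have -> : rset S u v :\ n = rset S' u v.
  by apply/setP => w; rewrite !inE andbA.
case: (L u v n) => /=; lia.
Qed.

Lemma invariant_count u : u \in S' ->
  (K.+1 - #|[set w in S' | (x w < x u)%O]|
     <= \sum_(v in S' | (x u < x v)%O) invariant u v)%N.
Proof.
move=> uS'; set Lo := [set w in S' | (x w < x u)%O]; set c := #|Lo|.
have xun := lt_max uS'.
pose A := [set v in S' | (x u < x v)%O].
(* [L u v n] places the edge to [v] below the edge to [n]: [B] collects the lower edges and [B'] the
   upper ones. *)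
pose B := [set v in A | L u v n]; pose B' := [set v in A | ~~ L u v n].
have ne a b : (x a < x b)%O -> a != b.
  by apply: contraTneq => ->; rewrite ltxx.
have cardA : (#|A| + c + 2 = #|S|)%N.
  rewrite card_S' (cardsD1 u S') uS' add1n addn2; congr _.+2.
  rewrite /c -cardsUI [X in (_ + X)%N](_ : _ = 0%N); last first.
    by apply: eq_card0 => w; rewrite !inE; case: ltgtP; rewrite ?andbF.
  rewrite addn0; apply: eq_card => w; rewrite !inE.
  case: (ltgtP (x u) (x w)) => [/ne|/ne|/x_inj ->]; rewrite ?eqxx ?andbF //=.
    by rewrite eq_sym => ->; rewrite orbF andbT.
  by move=> ->; rewrite andbT.
have cardB : (#|B| + #|B'| = #|A|)%N.
  rewrite -cardsUI [X in (_ + X)%N](_ : _ = 0%N); last first.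
    by apply: eq_card0 => w; rewrite !inE; case: (L u w n); rewrite ?andbF.
  by rewrite addn0; apply: eq_card => w; rewrite !inE; case: (L u w n); rewrite ?andbT ?andbF ?orbF.
have [tot tr] := L_right u.
have inA v : v \in A -> [/\ v \in S', (x u < x v)%O, v != n & v \in [set v | (x u < x v)%O]].
  by rewrite !inE => /andP[/andP[vn vS] uv]; split => //; rewrite vn.
have nR : n \in [set v | (x u < x v)%O] by rewrite inE.
have tA : transitive_tournament (L u) A.
  by apply: transitive_tournamentS (L_right u); apply/fintype.subsetP => v /inA[].
have tB : transitive_tournament (L u) B.
  by apply: transitive_tournamentS tA; apply/fintype.subsetP => v; rewrite inE => /andP[].
(* The order is reversed on [B'], so that ranks there count from the top. *)
have tB' : transitive_tournament (fun v w => L u w v) B'.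
  apply/transitive_tournamentC; apply: transitive_tournamentS tA.
  by apply/fintype.subsetP => v; rewrite inE => /andP[].
(* A vertex [w] on the right side either lies left of [u], which gives [c], or has its edge from [u]
   below the edge to [v]. In the second case transitivity puts that edge below the edge to [n] too,
   so the rank within [B] counts [w]. *)
have leB : {in B, forall v, (#|rset S' u v| <= c + rank (L u) B v)%N}.
  move=> v; rewrite inE => /andP[/inA[vS' uv vn vR] Lvn].
  apply: leq_trans (leq_card_setU _ _); apply: subset_leq_card.
  apply/fintype.subsetP => w; rewrite [in X in X -> _]inE => /and4P[wS' wu wv Lw].
  rewrite !inE; move: (wS'); rewrite !inE => /andP[wn wS].
  rewrite wn wS wv /=; case: (ltgtP (x w) (x u)) => [//|uw|/x_inj]; last first.
    by move=> E; rewrite E eqxx in wu.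
  have wR : w \in [set v | (x u < x v)%O] by rewrite inE.
  have Lwv : L u w v by rewrite tot.
  by rewrite Lwv (tr w v n).
have leB' : {in B', forall v, (#|lset S' u v| <= c + rank (fun v w => L u w v) B' v)%N}.
  move=> v; rewrite inE => /andP[/inA[vS' uv vn vR] Lvn].
  apply: leq_trans (leq_card_setU _ _); apply: subset_leq_card.
  apply/fintype.subsetP => w; rewrite [in X in X -> _]inE => /and4P[wS' wu wv Lw].
  rewrite !inE; move: (wS'); rewrite !inE => /andP[wn wS].
  rewrite wn wS wv /=; case: (ltgtP (x w) (x u)) => [//|uw|/x_inj]; last first.
    by move=> E; rewrite E eqxx in wu.
  have wR : w \in [set v | (x u < x v)%O] by rewrite inE.
  rewrite Lw andbT -tot // 1?eq_sym //; apply: (tr n v w) => //; rewrite 1?eq_sym //.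
  by rewrite tot // eq_sym.
have h1 := count_low_rank K tB leB; have h2 := count_low_rank K tB' leB'.
(* If neither minimum reaches [K.+1 - c], they add up to [#|A|], which [SK] makes large enough. *)
apply: (@leq_trans (minn #|B| (K.+1 - c) + minn #|B'| (K.+1 - c))); first lia.
apply: leq_trans (leq_add h1 h2) _.
rewrite [X in (_ <= X)%N](bigID (fun v => L u v n)) /=; apply: leq_add.
  rewrite big_mkcond [X in (_ <= X)%N]big_mkcond /=; apply: leq_sum => v _.
  rewrite !inE /invariant.
  by case: (L u v n); rewrite ?andbT ?andbF.
rewrite big_mkcond [X in (_ <= X)%N]big_mkcond /=; apply: leq_sum => v _.
rewrite !inE /invariant.
by case: (L u v n); rewrite ?andbT ?andbF.
Qed.

Lemma total_weight_step :
  (total_weight S' K + 3 * 'C(K.+2, 2) <= total_weight S K.+1)%N.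
Proof.
have SS := card_S'.
have lt_tour : transitive_tournament (fun u v => (x u < x v)%O) S'.
  split => [u v _ _ uv|u v w _ _ _ _ _ _]; last exact: lt_trans.
  by rewrite -leNgt lt_neqAle (inj_eq x_inj) uv.
have -> : total_weight S K.+1 = (\sum_(u in S') weight S K.+1 u n +
   \sum_(u in S') \sum_(v in S' | (x u < x v)%O) weight S K.+1 u v)%N.
  rewrite /total_weight (big_setD1 n) //= big_pred0 ?add0n; last first.
    by move=> v; apply/negP => /andP[vS]; rewrite ltNge n_max.
  rewrite -big_split; apply: eq_bigr => u uS' /=.
  rewrite (bigD1 n) /=; last by rewrite nS lt_max.
  by congr addn; apply: eq_bigl => v; rewrite !inE andbAC [(v != n) && _]andbC.
have -> : (3 * 'C(K.+2, 2) = 'C(K.+2, 2).*2 + 'C(K.+2, 2))%N by lia.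
rewrite addnCA leq_add ?weight_at_max //.
(* Through ranks in the order of abscissas, the remaining binomial is distributed as [K.+1 - c] over
   the vertices [u] with [c] vertices of [S'] to their left. *)
rewrite -(@sum_subn K.+1 #|S'|); last by lia.
rewrite -(sum_rank (fun i => (K.+1 - i)%N) lt_tour) -big_split /=.
apply: leq_sum => u uS'.
have -> : rank (fun u v => (x u < x v)%O) S' u = #|[set w in S' | (x w < x u)%O]|.
  apply: eq_card => w; rewrite !inE; case: (eqVneq w u) => [->|_] //=.
  by rewrite ltxx andbF.
apply: leq_trans (leq_add (leqnn _) (invariant_count uS')) _.
rewrite -big_split /=; apply: leq_sum => v /andP[vS' uv].
by apply: weight_invariant => //; apply: contraTneq uv => ->; rewrite ltxx.
Qed.

End Step.

(** Induction on [K] for all sets: removing the rightmost vertex lowers [K] by one and costs one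
    term of Pascal's rule. *)
Lemma total_weight_ge S K : (K.*2 < #|S|)%N ->
  (3 * 'C(K.+2, 3) <= total_weight S K)%N.
Proof.
elim: K S => [|K IH] S SK; first by rewrite bin_small.
have [n0 n0S] : exists n, n \in S by apply/set0Pn; rewrite -card_gt0; lia.
case: (Order.TotalTheory.arg_maxP x n0S) => n nS nmax; have {}nS : n \in S by [].
have := total_weight_step nS nmax SK; apply: leq_trans.
have -> : ('C(K.+3, 3) = 'C(K.+2, 3) + 'C(K.+2, 2))%N by rewrite binS.
rewrite mulnDr leq_add2r; apply: IH.
by have := cardsD1 n S; rewrite nS; lia.
Qed.

End Chirotope.

Local Open Scope classical_set_scope.
Local Open Scope ring_scope.

(** * Winding numbers *)

Section Angle.
Context {R : realType}.
Implicit Types (X Y s : R) (p q : R * R).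

Definition hypot X Y : R := Num.sqrt (X ^+ 2 + Y ^+ 2).

(* Half-angle formula for the angle from (0, -1) to (X, Y), taken in ]-pi, pi[;
   it is continuous off the closed upward vertical ray. *)
Definition angle X Y : R := 2 * atan (X / (hypot X Y - Y)).

Lemma hypot_sqr X Y : hypot X Y ^+ 2 = X ^+ 2 + Y ^+ 2.
Proof. by rewrite sqr_sqrtr // addr_ge0 ?sqr_ge0. Qed.

Lemma hypot_ge0 X Y : 0 <= hypot X Y.
Proof. exact: sqrtr_ge0. Qed.

(** The hypothesis puts [(X, Y)] off the closed upward ray, which is exactly where the denominator
    in [angle] vanishes. *)
Lemma hypot_gt X Y : (X = 0 -> Y < 0) -> Y < hypot X Y.
Proof.
move=> slit; have r2 := hypot_sqr X Y; have r0 := hypot_ge0 X Y.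
case: (eqVneq X 0) => [X0|X0]; first by have := slit X0; lra.
have : 0 < X ^+ 2 by rewrite exprn_even_gt0 //= X0.
by move=> X2; rewrite ltNge; apply/negP => rY; nra.
Qed.

Lemma hypot_gt0 X Y : (X = 0 -> Y < 0) -> 0 < hypot X Y.
Proof.
move=> slit; rewrite sqrtr_gt0; case: (eqVneq X 0) => [X0|X0].
  by rewrite X0; have := slit X0; nra.
have : 0 < X ^+ 2 by rewrite exprn_even_gt0 //= X0.
by have := sqr_ge0 Y; lra.
Qed.

Lemma cos_2atan s : cos (2 * atan s) = (1 - s ^+ 2) / (1 + s ^+ 2).
Proof.
have s1 : 1 + s ^+ 2 != 0 by rewrite gt_eqF // ltr_pwDl ?sqr_ge0.
rewrite mulr_natl cos_mulr2n cos_atan exprVn sqr_sqrtr; last by rewrite addr_ge0 ?sqr_ge0.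
by field.
Qed.

Lemma sin_2atan s : sin (2 * atan s) = 2 * s / (1 + s ^+ 2).
Proof.
have s1 : 1 + s ^+ 2 != 0 by rewrite gt_eqF // ltr_pwDl ?sqr_ge0.
have c0 : cos (atan s) != 0.
  by rewrite cos_atan invr_neq0 // gt_eqF // sqrtr_gt0 ltr_pwDl ?sqr_ge0.
have -> : sin (2 * atan s) = 2 * s * cos (atan s) ^+ 2.
  rewrite mulr_natl sin_mulr2n -{3}(atanK s) /tan; field.
  exact: c0.
rewrite cos_atan exprVn sqr_sqrtr; last by rewrite addr_ge0 ?sqr_ge0.
by field.
Qed.

(** Angles start at [(0, -1)], hence the direction [(sin, - cos)]. For the half-angle tangent
    [s = X / (r - Y)], with [r] the hypotenuse, the sine and cosine of [2 * atan s] reduce to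
    [X / r] and [- Y / r]. *)
Lemma angle_polar X Y : (X = 0 -> Y < 0) ->
  X = hypot X Y * sin (angle X Y) /\ Y = - (hypot X Y * cos (angle X Y)).
Proof.
move=> slit; have h := hypot_gt slit; have h0 := hypot_gt0 slit.
have h2 := hypot_sqr X Y.
rewrite /angle cos_2atan sin_2atan; set r := hypot X Y in h h0 h2 *.
have d0 : r - Y != 0 by rewrite gt_eqF // subr_gt0.
have -> : 1 + (X / (r - Y)) ^+ 2 = 2 * r / (r - Y).
  have -> : 1 + (X / (r - Y)) ^+ 2 = ((r - Y) ^+ 2 + X ^+ 2) / (r - Y) ^+ 2 by field.
  have -> : X ^+ 2 = r ^+ 2 - Y ^+ 2 by lra.
  by field.
have -> : 1 - (X / (r - Y)) ^+ 2 = - 2 * Y / (r - Y).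
  have -> : 1 - (X / (r - Y)) ^+ 2 = ((r - Y) ^+ 2 - X ^+ 2) / (r - Y) ^+ 2 by field.
  have -> : X ^+ 2 = r ^+ 2 - Y ^+ 2 by lra.
  by field.
by split; field; rewrite d0 gt_eqF.
Qed.

Lemma atan_inv s : 0 < s -> atan s + atan s^-1 = pi / 2.
Proof.
move=> s0; have a0 : 0 < atan s by rewrite -(@atan0 R) lt_atan.
have a1 := atan_ltpi2 s; set a := atan s in a0 a1 *.
have -> : s^-1 = tan (- a + pi / 2).
  rewrite /tan sinDpihalf cosDpihalf cosN sinN opprK -(atanK s) /tan invf_div //.
rewrite tanK; first by ring.
by rewrite in_itv /=; apply/andP; split; lra.
Qed.

Lemma angle_opp X Y : angle (- X) Y = - angle X Y.
Proof. by rewrite /angle /hypot sqrrN mulNr atanN mulrN. Qed.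

(** The half-angle tangents [X / (r - Y)] and [X / (r + Y)] are reciprocal because
    [X ^+ 2 = r ^+ 2 - Y ^+ 2], so the half-angles add up to [pi / 2]. *)
Lemma angle_compl_pos X Y : 0 < X -> angle X Y + angle X (- Y) = pi.
Proof.
move=> X0; have sl : X = 0 -> Y < 0 by lra.
have sl' : X = 0 -> - Y < 0 by lra.
have h := hypot_gt sl; have h' := hypot_gt sl'; have h2 := hypot_sqr X Y.
have e : hypot X (- Y) = hypot X Y by rewrite /hypot sqrrN.
rewrite e in h'; rewrite /angle e opprK -mulrDr; set r := hypot X Y in h h' h2 *.
have -> : X / (r + Y) = (X / (r - Y))^-1.
  have X1 : X != 0 by rewrite gt_eqF.
  have X2 : r + Y != 0 by rewrite gt_eqF //; lra.
  rewrite invf_div; apply/eqP; rewrite eqr_div //.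
  by rewrite -expr2 -subr_sqr h2 addrK.
rewrite atan_inv; first by field.
by rewrite divr_gt0 // subr_gt0.
Qed.

Lemma angle_compl_neg X Y : X < 0 -> angle X Y + angle X (- Y) = - pi.
Proof.
move=> X0; have := @angle_compl_pos (- X) Y; rewrite oppr_gt0 X0 !angle_opp.
by move=> /(_ isT) <-; ring.
Qed.

Lemma cvg_angle (T : Type) (F : set_system T) (FF : Filter F) (f1 f2 : T -> R) X Y :
  f1 @ F --> X -> f2 @ F --> Y -> (X = 0 -> Y < 0) ->
  (fun t => angle (f1 t) (f2 t)) @ F --> angle X Y.
Proof.
move=> c1 c2 slit; have h := hypot_gt slit.
have cr : (fun t => hypot (f1 t) (f2 t)) @ F --> hypot X Y.
  apply: (cvg_comp (fun t => f1 t ^+ 2 + f2 t ^+ 2) Num.sqrt).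
    by apply: cvgD; [exact: (cvgM c1 c1)|exact: (cvgM c2 c2)].
  exact: sqrt_continuous.
have d0 : hypot X Y - Y != 0 by rewrite gt_eqF // subr_gt0.
have cs : (fun t => f1 t / (hypot (f1 t) (f2 t) - f2 t)) @ F --> X / (hypot X Y - Y).
  by apply: cvgM; [exact: c1|apply: cvgV; [exact: d0|apply: cvgB]].
apply: cvgM; first exact: cvg_cst.
by apply: (cvg_comp _ _ cs); exact: continuous_atan.
Qed.

End Angle.

(** * Continuous arguments along a curve and winding numbers *)

Section Winding.
Context {R : realType}.
Implicit Types (g : R -> R * R) (p q : R * R) (A : set R) (a b c t : R) (theta : R -> R).

Lemma within_continuous_within_comp (T : topologicalType) (f : R -> T) (B A : set R) (h : R -> R) :
  {within B, continuous f} -> {within A, continuous h} -> (forall t, A t -> B (h t)) ->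
  {within A, continuous (f \o h)}.
Proof.
move=> /subspace_continuousP cf /subspace_continuousP ch AB.
apply/subspace_continuousP => x Ax.
apply: cvg_comp (cf _ (AB _ Ax)) => P; rewrite /within /= => BP.
have H : within A (nbhs x) (h @^-1` (fun y => B y -> P y)) := ch x Ax _ BP.
have : nbhs x (fun t => A t -> P (h t)).
  rewrite /within /= in H; apply: filterS H => t /= BPt At.
  exact: (BPt At (AB _ At)).
by [].
Qed.

Lemma within_continuous_precomp (T : topologicalType) (f : R -> T) (B A : set R) (h : R -> R) :
  {within B, continuous f} -> continuous h -> (forall t, A t -> B (h t)) ->
  {within A, continuous (f \o h)}.
Proof.
move=> cf ch; apply: within_continuous_within_comp cf _.
exact: continuous_subspaceT.
Qed.

Lemma within_continuous_cat (T : topologicalType) (f : R -> T) a b c :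
  {within `[a, b], continuous f} -> {within `[b, c], continuous f} ->
  {within `[a, c], continuous f}.
Proof.
move=> c1 c2; apply: (@continuous_subspaceW _ _ _ (`[a, b] `|` `[b, c])).
  move=> t /=; rewrite !in_itv /= => /andP[at_ tc].
  by case: (leP t b) => tb; [left|right]; rewrite ?at_ ?tb // (ltW tb) tc.
by apply: withinU_continuous => //; exact: itv_closed.
Qed.

Lemma within_continuous_glue (T : topologicalType) (f h : R -> T) a b c :
  {within `[a, b], continuous f} -> {within `[b, c], continuous h} -> f b = h b ->
  {within `[a, c], continuous (fun t => if t <= b then f t else h t)}.
Proof.
move=> cf ch fh; apply: (@within_continuous_cat _ _ _ b).
  apply: subspace_eq_continuous cf => t; rewrite inE /= in_itv /= => /andP[_ tb].
  by change (f t = if t <= b then f t else h t); rewrite tb.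
apply: subspace_eq_continuous ch => t; rewrite inE /= in_itv /= => /andP[bt _].
change (h t = if t <= b then f t else h t).
by case: leP => // tb; have -> : t = b by apply/eqP; rewrite eq_le tb bt.
Qed.

Definition lifts g A p theta : Prop :=
  {within A, continuous theta} /\
  forall t, A t -> exists2 r : R, 0 < r &
    g t = (p.1 + r * cos (theta t), p.2 + r * sin (theta t)).

Lemma within_cvg_coord g A t : {within A, continuous g} -> A t ->
  (fun s => (g s).1) @ within A (nbhs t) --> (g t).1 /\
  (fun s => (g s).2) @ within A (nbhs t) --> (g t).2.
Proof.
move=> /subspace_continuousP cg At; have cgt := cg _ At.
by split; apply: (cvg_comp _ _ cgt); [exact: cvg_fst|exact: cvg_snd].
Qed.

(** A curve meeting the vertical line through [p] only below [p] avoids the ray where [angle] is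
    discontinuous. Subtracting [pi / 2] turns the angle from [(0, -1)] into the argument. *)
Lemma lifts_below g A p : {within A, continuous g} ->
  (forall t, A t -> (g t).1 = p.1 -> (g t).2 < p.2) ->
  lifts g A p (fun t => angle ((g t).1 - p.1) ((g t).2 - p.2) - pi / 2).
Proof.
move=> cg bel; have slit t : A t -> (g t).1 - p.1 = 0 -> (g t).2 - p.2 < 0.
  by move=> At /subr0_eq /(bel _ At); rewrite subr_lt0.
split.
  apply/subspace_continuousP => t At; have [c1 c2] := within_cvg_coord cg At.
  apply: cvgB; last exact: cvg_cst.
  by apply: cvg_angle (slit t At); apply: cvgB => //; exact: cvg_cst.
move=> t At; have [hX hY] := angle_polar (slit t At).
exists (hypot ((g t).1 - p.1) ((g t).2 - p.2)).
  exact: hypot_gt0 (slit t At).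
rewrite cosBpihalf sinBpihalf -hX mulrN -hY.
by case: (g t) => x y /=; congr pair; ring.
Qed.

(** Reflection in the horizontal line through [p] exchanges above and below and negates the
    argument. *)
Lemma lifts_above g A p : {within A, continuous g} ->
  (forall t, A t -> (g t).1 = p.1 -> p.2 < (g t).2) ->
  lifts g A p (fun t => pi / 2 - angle ((g t).1 - p.1) (p.2 - (g t).2)).
Proof.
move=> cg abv; have slit t : A t -> (g t).1 - p.1 = 0 -> p.2 - (g t).2 < 0.
  by move=> At /subr0_eq /(abv _ At); rewrite subr_lt0.
split.
  apply/subspace_continuousP => t At; have [c1 c2] := within_cvg_coord cg At.
  apply: cvgB; first exact: cvg_cst.
  by apply: cvg_angle (slit t At); apply: cvgB => //; exact: cvg_cst.
move=> t At; have [hX hY] := angle_polar (slit t At).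
exists (hypot ((g t).1 - p.1) (p.2 - (g t).2)).
  exact: hypot_gt0 (slit t At).
rewrite -[pi / 2 - _]opprB cosN sinN cosBpihalf sinBpihalf opprK -hX.
by move: hY; case: (g t) => x y /= hY; congr pair; lra.
Qed.

Lemma lifts_glue g p theta1 theta2 a b c :
  lifts g `[a, b] p theta1 -> lifts g `[b, c] p theta2 -> theta1 b = theta2 b ->
  lifts g `[a, c] p (fun t => if t <= b then theta1 t else theta2 t).
Proof.
move=> [c1 p1] [c2 p2] e; split; first exact: within_continuous_glue.
move=> t; rewrite /= in_itv /= => /andP[at_ tc].
case: leP => tb; [apply: p1|apply: p2]; rewrite /= in_itv /= ?at_ ?tb //.
by rewrite (ltW tb).
Qed.

Lemma lifts_winding_number g a b p theta (k : int) : lifts g `[a, b] p theta ->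
  theta b - theta a = k%:~R * (2 * pi) -> winding_number g a b p k.
Proof. by move=> [cth pol] e; exists theta; split => // t tab; apply: pol. Qed.

Lemma winding_number_lifts g a b p (k : int) : winding_number g a b p k ->
  exists2 theta, lifts g `[a, b] p theta & theta b - theta a = k%:~R * (2 * pi).
Proof. by move=> [theta [cth pol e]]; exists theta. Qed.

(** The lift depends on the point [g t] only, so it returns to its first value when the curve
    closes. *)
Lemma winding_number_below g a b p : {within `[a, b], continuous g} -> g a = g b ->
  (forall t, t \in `[a, b] -> (g t).1 = p.1 -> (g t).2 < p.2) ->
  winding_number g a b p 0.
Proof.
move=> cg gab bel; apply: lifts_winding_number (lifts_below cg bel) _.
by rewrite gab subrr mul0r.
Qed.

Lemma winding_number_above g a b p : {within `[a, b], continuous g} -> g a = g b ->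
  (forall t, t \in `[a, b] -> (g t).1 = p.1 -> p.2 < (g t).2) ->
  winding_number g a b p 0.
Proof.
move=> cg gab abv; apply: lifts_winding_number (lifts_above cg abv) _.
by rewrite gab subrr mul0r.
Qed.

Section TwoPaths.
Variables (g : R -> R * R) (a b c : R) (p : R * R).
Hypotheses (ab : a <= b) (bc : b < c).
Hypotheses (cg1 : {within `[a, b], continuous g}) (cg2 : {within `[b, c], continuous g}).
Hypotheses (gac : g a = g c) (ap : (g a).1 < p.1) (pb : p.1 < (g b).1).

(** The lifts for the lower and the upper path agree at [g b], right of [p], by [angle_compl_pos],
    and differ by a full turn at [g a = g c], left of [p], by [angle_compl_neg]. *)
Lemma winding_number_ccw :
  (forall t, t \in `[a, b] -> (g t).1 = p.1 -> (g t).2 < p.2) ->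
  (forall t, t \in `[b, c] -> (g t).1 = p.1 -> p.2 < (g t).2) ->
  winding_number g a c p 1.
Proof.
move=> bel abv.
apply: lifts_winding_number (lifts_glue (lifts_below cg1 bel) (lifts_above cg2 abv) _) _ => /=.
  have := @angle_compl_pos R ((g b).1 - p.1) ((g b).2 - p.2).
  by rewrite subr_gt0 pb opprB => /(_ isT); lra.
rewrite ab leNgt bc /= -gac.
have := @angle_compl_neg R ((g a).1 - p.1) ((g a).2 - p.2).
by rewrite subr_lt0 ap opprB => /(_ isT); lra.
Qed.

Lemma winding_number_cw :
  (forall t, t \in `[a, b] -> (g t).1 = p.1 -> p.2 < (g t).2) ->
  (forall t, t \in `[b, c] -> (g t).1 = p.1 -> (g t).2 < p.2) ->
  winding_number g a c p (-1).
Proof.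
move=> abv bel.
apply: lifts_winding_number (lifts_glue (lifts_above cg1 abv) (lifts_below cg2 bel) _) _ => /=.
  have := @angle_compl_pos R ((g b).1 - p.1) ((g b).2 - p.2).
  by rewrite subr_gt0 pb opprB => /(_ isT); lra.
rewrite ab leNgt bc /= -gac.
have := @angle_compl_neg R ((g a).1 - p.1) ((g a).2 - p.2).
by rewrite subr_lt0 ap opprB => /(_ isT); lra.
Qed.

End TwoPaths.

(** If [delta] ended higher, it would take a value [delta a + e] with [0 < e <= pi], whose cosine is
    [cos e < 1]. *)
Lemma cos_eq1_nondecreasing (delta : R -> R) a b : a <= b ->
  {within `[a, b], continuous delta} -> (forall t, t \in `[a, b] -> cos (delta t) = 1) ->
  delta b <= delta a.
Proof.
move=> ab cd cos1; rewrite leNgt; apply/negP => lt_ab.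
have pi0 := @pi_gt0 R.
pose e := Num.min ((delta b - delta a)) pi.
have e0 : 0 < e by rewrite lt_min subr_gt0 lt_ab pi0.
have e1 : e <= delta b - delta a by rewrite ge_min lexx.
have e2 : e <= pi by rewrite ge_min lexx orbT.
have [t tab dt] : exists2 t, t \in `[a, b] & delta t = delta a + e.
  by apply: IVT => //; rewrite ?(min_idPl _) ?(max_idPr _) ?(ltW lt_ab) //; lra.
have := cos1 _ tab; rewrite dt cosD.
have ca : cos (delta a) = 1 by rewrite cos1 // in_itv /= lexx.
have -> : sin (delta a) = 0 by apply: cos1sin0; rewrite ca normr1.
rewrite ca mul1r mul0r subr0 => ce.
have : cos e < cos 0 by rewrite ltr_cos // in_itv /= ?lexx ?(ltW e0) ?(ltW pi0).
by rewrite cos0 ce ltxx.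
Qed.

(** Two lifts of one curve give the same radii and directions, so their difference has cosine 1.
    Applying [cos_eq1_nondecreasing] to the difference and to its opposite shows that it is equal at
    [a] and [b]. *)
Lemma winding_number_unique g a b p (k l : int) : a <= b ->
  winding_number g a b p k -> winding_number g a b p l -> k = l.
Proof.
move=> ab [th1 [c1 p1 e1]] [th2 [c2 p2 e2]].
have cos1 t : t \in `[a, b] -> cos (th1 t - th2 t) = 1.
  move=> tab; have [r1 r10 E] := p1 t tab; have [r2 r20] := p2 t tab.
  rewrite E => -[/addrI ec /addrI es].
  have s1 := cos2Dsin2 (th1 t); have s2 := cos2Dsin2 (th2 t).
  have rr : r1 = r2.
    apply/eqP; rewrite -(eqrXn2 (n := 2)) ?ltW //; apply/eqP.
    have -> : r1 ^+ 2 = (r1 * cos (th1 t)) ^+ 2 + (r1 * sin (th1 t)) ^+ 2.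
      by rewrite !exprMn -mulrDr s1 mulr1.
    by rewrite ec es !exprMn -mulrDr s2 mulr1.
  move: ec es; rewrite rr => /mulfI ec /mulfI es.
  by rewrite cosB ec ?es ?gt_eqF // -!expr2.
have cd : {within `[a, b], continuous (fun t => th1 t - th2 t)}.
  by move=> t; apply: cvgB; [exact: c1|exact: c2].
have cd' : {within `[a, b], continuous (fun t => th2 t - th1 t)}.
  by move=> t; apply: cvgB; [exact: c2|exact: c1].
have h1 := cos_eq1_nondecreasing ab cd cos1.
have h2 : th2 b - th1 b <= th2 a - th1 a.
  by apply: (cos_eq1_nondecreasing ab cd') => t tab; rewrite -opprB cosN cos1.
have : (k%:~R * (2 * pi) : R) = l%:~R * (2 * pi) by rewrite -e1 -e2; lra.
move/mulIf => /(_ _) /intr_inj; apply.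
by rewrite mulf_neq0 // gt_eqF // pi_gt0.
Qed.

Lemma winding_number_reverse g h b p (k : int) :
  (forall t, t \in `[0, b] -> h t = g (b - t)) ->
  winding_number g 0 b p k -> winding_number h 0 b p (- k).
Proof.
move=> hE /winding_number_lifts[theta [cth pol] e].
have flip t : [set` `[0, b]] t -> [set` `[0, b]] (b - t) by rewrite /= !in_itv /=; lra.
apply: (@lifts_winding_number _ _ _ _ (theta \o (fun t => b - t))).
  split; last by move=> t tb; rewrite hE //; apply: pol; exact: flip.
  apply: within_continuous_precomp cth _ flip => t.
  by apply: cvgB; [exact: cvg_cst|exact: cvg_id].
by rewrite /= subrr subr0 mulrNz mulNr -e opprB.
Qed.

(** The closed curve is started at parameter [b] instead of 0. Past the old end point the lift
    continues with its old values plus [k] full turns. *)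
Lemma winding_number_shift g h b c p (k : int) : 0 <= b -> b < c ->
  (forall t, t \in `[0, c - b] -> h t = g (t + b)) ->
  (forall t, t \in `[c - b, c] -> h t = g (t - (c - b))) ->
  winding_number g 0 c p k -> winding_number h 0 c p k.
Proof.
move=> b0 bc h1 h2 /winding_number_lifts[theta [cth pol] e].
have mv1 t : [set` `[0, c - b]] t -> [set` `[0, c]] (t + b) by rewrite /= !in_itv /=; lra.
have mv2 t : [set` `[c - b, c]] t -> [set` `[0, c]] (t - (c - b)) by rewrite /= !in_itv /=; lra.
have l1 : lifts h `[0, c - b] p (theta \o (fun t => t + b)).
  split; last by move=> t tb; rewrite h1 //; apply: pol; exact: mv1.
  apply: within_continuous_precomp cth _ mv1 => t.
  by apply: cvgD; [exact: cvg_id|exact: cvg_cst].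
have l2 : lifts h `[c - b, c] p
    (fun t => theta (t - (c - b)) + k%:~R * (2 * pi)).
  split.
    move=> t; apply: cvgD; last exact: cvg_cst.
    apply: (within_continuous_precomp cth _ mv2) => {}t.
    by apply: cvgB; [exact: cvg_id|exact: cvg_cst].
  move=> t tb; have [r r0 E] := pol _ (mv2 t tb); exists r => //.
  rewrite h2 // E; have per (x : R) (m : int) :
      cos (x + m%:~R * (2 * pi)) = cos x /\ sin (x + m%:~R * (2 * pi)) = sin x.
    have pern (y : R) (j : nat) :
        cos (y + j%:R * (2 * pi)) = cos y /\ sin (y + j%:R * (2 * pi)) = sin y.
      have -> : j%:R * (2 * pi) = (pi *+ 2) *+ j :> R by rewrite -[RHS]mulr_natl -[pi *+ 2]mulr_natl.
      by split; apply: periodicn; [exact: cosD2pi|exact: sinD2pi].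
    case: m => j; first exact: pern.
    rewrite NegzE mulrNz mulNr.
    have [hc hs] := pern (x - j.+1%:~R * (2 * pi)) j.+1.
    by rewrite -hc -hs; split; congr (_ _); ring.
  by have [-> ->] := per (theta (t - (c - b))) k.
apply: lifts_winding_number (lifts_glue l1 l2 _) _ => /=.
  by rewrite subrr subrK; move: e; lra.
have -> : 0 <= c - b by lra.
(* If [b = 0], the end point [c] falls into the first branch of the glued lift. *)
rewrite add0r; case: (leP c (c - b)) => cb.
  have -> : b = 0 by lra.
  by rewrite addr0.
have -> : c - (c - b) = b by ring.
by lra.
Qed.

End Winding.

(** * Closed curves that follow one graph to the right and return along another *)

Section TwoGraphs.
Context {R : realType}.
Variables (g : R -> R * R) (a b c : R) (xl xr : R) (F G : R -> R).
Hypotheses (ab : a < b) (bc : b < c) (xlr : xl < xr).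
Hypotheses (cg1 : {within `[a, b], continuous g}) (cg2 : {within `[b, c], continuous g}).
Hypotheses (gac : g a = g c) (ga : (g a).1 = xl) (gb : (g b).1 = xr).
Hypothesis gF : forall t, t \in `[a, b] ->
  (g t).1 \in `[xl, xr] /\ (g t).2 = F (g t).1.
Hypothesis gG : forall t, t \in `[b, c] ->
  (g t).1 \in `[xl, xr] /\ (g t).2 = G (g t).1.

Let cg : {within `[a, c], continuous g} := within_continuous_cat cg1 cg2.

Let ia : a \in `[a, b]. Proof. by rewrite in_itv /= lexx ltW. Qed.
Let ib : b \in `[a, b]. Proof. by rewrite in_itv /= lexx ltW. Qed.
Let ib' : b \in `[b, c]. Proof. by rewrite in_itv /= lexx ltW. Qed.
Let ic : c \in `[b, c]. Proof. by rewrite in_itv /= lexx ltW. Qed.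

Let i1 t : t \in `[a, b] -> t \in `[a, c].
Proof. by rewrite !in_itv /=; have := bc; lra. Qed.
Let i2 t : t \in `[b, c] -> t \in `[a, c].
Proof. by rewrite !in_itv /=; have := ab; lra. Qed.
Let i12 t : t \in `[a, c] -> t \in `[a, b] \/ t \in `[b, c].
Proof.
rewrite !in_itv /= => /andP[h1 h2].
by case: (leP t b) => tb; [left|right]; rewrite ?h1 ?(ltW tb).
Qed.

Lemma two_graphs_hit x : x \in `[xl, xr] ->
  (exists2 t, t \in `[a, b] & g t = (x, F x)) /\
  (exists2 t, t \in `[b, c] & g t = (x, G x)).
Proof.
rewrite in_itv /= => xx.
have coord u v : {within `[u, v], continuous g} -> {within `[u, v], continuous (fst \o g)}.
  move=> cuv; apply/subspace_continuousP => t tuv.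
  by have [] := within_cvg_coord cuv tuv.
have [|t tab /= gt] := @IVT R (fst \o g) a b x (ltW ab) (coord _ _ cg1).
  by rewrite /= ga gb (min_idPl _) ?(max_idPr _) // ltW.
have [|s sbc /= gs] := @IVT R (fst \o g) b c x (ltW bc) (coord _ _ cg2).
  by rewrite /= -gac ga gb (min_idPr _) ?(max_idPl _) // ltW.
split; [exists t => //; have [_] := gF tab|exists s => //; have [_] := gG sbc].
  by case: (g t) gt => y z /= -> ->.
by case: (g s) gs => y z /= -> ->.
Qed.

Let ends : F xl = G xl /\ F xr = G xr.
Proof.
have [_ f1] := gF ia; have [_ f2] := gF ib; have [_ g1] := gG ib'; have [_ g2] := gG ic.
by rewrite -ga -gb -f1 -f2 -g1 {2}gac -g2 gac.
Qed.

(** The curve meets the vertical line through [p] at most at heights [F p.1] and [G p.1], so their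
    order relative to [p.2] decides; if the line misses the curve, lying below [p] holds vacuously.
    A point between the graphs is not over an end, where [F] and [G] agree. *)
Lemma winding_number_two_graphs p : (forall t, t \in `[a, c] -> g t <> p) ->
  [\/ winding_number g a c p 0,
      [/\ p.1 \in `]xl, xr[, F p.1 < p.2, p.2 < G p.1 & winding_number g a c p 1] |
      [/\ p.1 \in `]xl, xr[, G p.1 < p.2, p.2 < F p.1 & winding_number g a c p (-1)]].
Proof.
move=> off; case: (boolP (p.1 \in `[xl, xr])) => [pin|pout]; last first.
  apply: Or31; apply: winding_number_below => // t /i12[/gF|/gG] [h _] e;
    by rewrite e (negbTE pout) in h.
have [[t tab gt] [s sbc gs]] := two_graphs_hit pin.
have nF : F p.1 != p.2.
  by apply/eqP => e; apply: (off t (i1 tab)); rewrite gt e -surjective_pairing.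
have nG : G p.1 != p.2.
  by apply/eqP => e; apply: (off s (i2 sbc)); rewrite gs e -surjective_pairing.
have inner : F p.1 != G p.1 -> xl < p.1 /\ p.1 < xr.
  move: pin; rewrite in_itv /= => /andP[h1 h2] FG; have [e1 e2] := ends.
  split; rewrite lt_neqAle ?h1 ?h2 andbT; apply: contraNneq FG => e.
    by rewrite -e e1.
  by rewrite e e2.
case: (ltgtP (F p.1) p.2) nF => // Fp _; case: (ltgtP (G p.1) p.2) nG => // Gp _.
- apply: Or31; apply: winding_number_below => // r /i12[/gF|/gG] [_ ->] ->; by [].
- have FG : F p.1 != G p.1 by rewrite lt_eqF // (lt_trans Fp).
  have [p1 p2] := inner FG; apply: Or32; split => //; first by rewrite in_itv /= p1.
  apply: (@winding_number_ccw R g a b c) => //; rewrite ?ga ?gb ?ltW //.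
    by move=> r /gF[_ ->] ->.
  by move=> r /gG[_ ->] ->.
- have FG : F p.1 != G p.1 by rewrite gt_eqF // (lt_trans Gp).
  have [p1 p2] := inner FG; apply: Or33; split => //; first by rewrite in_itv /= p1.
  apply: (@winding_number_cw R g a b c) => //; rewrite ?ga ?gb ?ltW //.
    by move=> r /gF[_ ->] ->.
  by move=> r /gG[_ ->] ->.
- apply: Or31; apply: winding_number_above => // r /i12[/gF|/gG] [_ ->] ->; by [].
Qed.

Lemma winding_number_avoids (k : int) p : winding_number g a c p k ->
  forall t, t \in `[a, c] -> g t <> p.
Proof.
move=> [theta [_ pol _]] t tac e; have [r r0] := pol t tac; rewrite e.
case: p e {pol} => x y _ [] /= hx hy; have := cos2Dsin2 (theta t).
have -> : cos (theta t) = 0.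
  by apply: (@mulfI _ r); rewrite ?gt_eqF // mulr0; lra.
have -> : sin (theta t) = 0.
  by apply: (@mulfI _ r); rewrite ?gt_eqF // mulr0; lra.
by rewrite expr0n /= addr0 => /eqP; rewrite eq_sym oner_eq0.
Qed.

Let ac : a <= c. Proof. by rewrite ltW // (lt_trans ab). Qed.

Let mid : (xl + xr) / 2 \in `]xl, xr[.
Proof. by rewrite in_itv /=; have := xlr; lra. Qed.

(** The point halfway between the graphs over the middle abscissa has winding number 1. By
    [winding_number_two_graphs] and uniqueness, winding number [-1] would require a point above [G]
    and below [F]. *)
Lemma two_graphs_ccw : (forall x, x \in `]xl, xr[ -> F x < G x) ->
  (exists p, winding_number g a c p 1) /\ ~ (exists p, winding_number g a c p (-1)).
Proof.
move=> FG; split.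
  have := mid; set x := (xl + xr) / 2 => xm; have lt := FG _ xm.
  have off t : t \in `[a, c] -> g t <> (x, (F x + G x) / 2).
    by move=> /i12[/gF|/gG] [_] + e; rewrite e /=; lra.
  exists (x, (F x + G x) / 2).
  apply: (@winding_number_ccw R g a b c) => //=; rewrite ?ga ?gb ?ltW //.
  - by move: xm; rewrite in_itv /=; lra.
  - by move: xm; rewrite in_itv /=; lra.
  - by move=> r /gF[_ ->] ->; lra.
  - by move=> r /gG[_ ->] ->; lra.
move=> [p wn]; have [w|[_ _ _ w]|[/FG pp Gp Fp _]] := winding_number_two_graphs (winding_number_avoids wn).
- by have := winding_number_unique ac wn w.
- by have := winding_number_unique ac wn w.
- by have := lt_trans Gp Fp; rewrite ltNge (ltW pp).
Qed.

Lemma two_graphs_cw : (forall x, x \in `]xl, xr[ -> G x < F x) ->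
  (exists p, winding_number g a c p (-1)) /\ ~ (exists p, winding_number g a c p 1).
Proof.
move=> FG; split.
  have := mid; set x := (xl + xr) / 2 => xm; have lt := FG _ xm.
  exists (x, (F x + G x) / 2).
  apply: (@winding_number_cw R g a b c) => //=; rewrite ?ga ?gb ?ltW //.
  - by move: xm; rewrite in_itv /=; lra.
  - by move: xm; rewrite in_itv /=; lra.
  - by move=> r /gF[_ ->] ->; lra.
  - by move=> r /gG[_ ->] ->; lra.
move=> [p wn]; have [w|[/FG pp Fp Gp _]|[_ _ _ w]] := winding_number_two_graphs (winding_number_avoids wn).
- by have := winding_number_unique ac wn w.
- by have := lt_trans Fp Gp; rewrite ltNge (ltW pp).
- by have := winding_number_unique ac wn w.
Qed.

End TwoGraphs.

(** * Monotone arcs as graphs of continuous functions *)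

Section ArcGraph.
Context {R : realType}.

(** The abscissa is continuous and injective along the arc, hence increasing with a continuous
    inverse [i]; the function is the ordinate composed with [i]. *)
Lemma arc_graph (g : R -> R * R) : simple_arc g -> (g 0).1 < (g 1).1 ->
  (forall p q, trace g p -> trace g q -> p.1 = q.1 -> p = q) ->
  exists2 h : R -> R, {within `[(g 0).1, (g 1).1], continuous h} &
    forall q, trace g q <-> q.1 \in `[(g 0).1, (g 1).1] /\ q.2 = h q.1.
Proof.
move=> [cg ginj] g01 tinj; pose f t := (g t).1.
have tr t : t \in `[0, 1] -> trace g (g t) by move=> t01; exists t.
have cf : {within `[0, 1], continuous f}.
  by apply/subspace_continuousP => t t01; have [] := within_cvg_coord cg t01.
have cg2 : {within `[0, 1], continuous (snd \o g)}.
  by apply/subspace_continuousP => t t01; have [] := within_cvg_coord cg t01.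
have finj : {in `[0, 1] &, injective f}.
  by move=> s t s01 t01 fst_; apply: ginj => //; apply: tinj => //; exact: tr.
have fle := segment_continuous_inj_le (ltW g01 : f 0 <= f 1) cf finj.
pose i x := xget 0 [set t | t \in `[0, 1] /\ f t = x].
have fK : {in `[0, 1], cancel f i}.
  move=> t t01; rewrite /i; case: xgetP => [s _ [s01 fs]|/(_ t)]; first exact: finj.
  by case.
have ci := segment_can_le_continuous ler01 cf fK.
have iK := segment_continuous_le_can_sym ler01 cf fK.
have z01 : 0 \in `[0, 1 : R] by rewrite in_itv /= lexx ler01.
have o01 : 1 \in `[0, 1 : R] by rewrite in_itv /= lexx ler01.
have i01 x : x \in `[f 0, f 1] -> i x \in `[0, 1].
  move=> xf; rewrite /i; case: xgetP => [s _ [s01 fs] //|_]; exact: z01.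
exists (snd \o g \o i).
  exact: within_continuous_within_comp cg2 ci i01.
move=> q; split.
  move=> [t t01 <-]; split; last by rewrite /= (fK t).
  move: (t01); rewrite /= !in_itv /= => /andP[t0 t1].
  rewrite -/(f t) -/(f 0) -/(f 1) !fle //.
move=> [q1 q2]; exists (i q.1); first exact: i01.
by rewrite [RHS]surjective_pairing q2 [LHS]surjective_pairing -/(f _) iK.
Qed.

End ArcGraph.

(** * Monotone semisimple drawings *)

Section MonotoneDrawing.
Context {R : realType} {n : nat} (D : drawing R n).
Hypotheses (hmono : x_monotone D) (hsemi : semisimple D).
Implicit Types (u v w : 'I_n) (x : R) (q : R * R).

Definition xpos u : R := (pos D u).1.
Definition ypos u : R := (pos D u).2.

(* 0 when no point of the edge has abscissa x. *)
Definition height u v x : R := xget 0 [set y | trace (edge_arc D (u, v)) (x, y)].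

Definition xspan u v x : bool := (xpos u <= x <= xpos v) || (xpos v <= x <= xpos u).

Lemma xspanC u v x : xspan u v x = xspan v u x.
Proof. exact: orbC. Qed.

Lemma xpos_neq u v : u != v -> xpos u != xpos v.
Proof. by move=> uv; apply/eqP; apply: hmono.2. Qed.

Lemma xpos_inj : injective xpos.
Proof. by move=> u v e; apply/eqP; apply: contraPT e => /xpos_neq /eqP. Qed.

Lemma trace_rev u v : u != v -> trace (edge_arc D (v, u)) = trace (edge_arc D (u, v)).
Proof.
have sub a b : a != b -> trace (edge_arc D (b, a)) `<=` trace (edge_arc D (a, b)).
  move=> ab q [t t01 <-]; exists (1 - t); last by rewrite (edge_rev D ab).
  by move: t01; rewrite /= !in_itv /=; lra.
by move=> uv; apply/seteqP; split; [exact: sub|apply: sub; rewrite eq_sym].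
Qed.

Lemma height_rev u v : u != v -> height v u = height u v.
Proof. by move=> uv; rewrite /height trace_rev. Qed.

Lemma edge_graph u v : u != v ->
  (forall x1 x2, xspan u v x1 -> xspan u v x2 ->
    {within `[x1, x2], continuous (height u v)}) /\
  (forall q, trace (edge_arc D (u, v)) q <-> xspan u v q.1 /\ q.2 = height u v q.1).
Proof.
(* Reversing an edge changes neither its trace nor its [height], so the left end may be taken
   first. *)
wlog lt_uv : u v / xpos u < xpos v => [wl uv|uv].
  case: (ltgtP (xpos u) (xpos v)) => [lt|lt|/xpos_inj e]; first exact: wl.
    have vu : v != u by rewrite eq_sym.
    have [h1 h2] := wl v u lt vu; rewrite -(height_rev vu) -(trace_rev vu) in h1 h2.
    split=> [x1 x2|q]; rewrite !(xspanC u); [exact: h1|exact: h2].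
  by rewrite e eqxx in uv.
have e0 : edge_arc D (u, v) 0 = pos D u by rewrite edge_start.
have e1 : edge_arc D (u, v) 1 = pos D v by rewrite edge_end.
have [] := @arc_graph R (edge_arc D (u, v)).
- exact: edge_simple.
- by rewrite e0 e1.
- by move=> p q; apply: hmono.1.
rewrite e0 e1 -/(xpos u) -/(xpos v) => h ch hE.
have rE x : xspan u v x = (x \in `[xpos u, xpos v]).
  rewrite in_itv /= /xspan; case: (boolP (_ <= x <= xpos v)) => //= _.
  by apply/negP; have := lt_uv; lra.
have hh x : x \in `[xpos u, xpos v] -> h x = height u v x.
  move=> xr; rewrite /height; case: xgetP => [y _ /hE[_] //|/(_ (h x))].
  by case; apply/hE.
split=> [x1 x2|q].
  rewrite !rE !in_itv /= => r1 r2; apply: (@continuous_subspaceW _ _ _ `[xpos u, xpos v]).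
    by move=> y; rewrite /= !in_itv /=; lra.
  by apply: subspace_eq_continuous ch => y; rewrite inE /= => /hh.
rewrite rE; split=> [/hE[q1 q2]|[q1 q2]]; first by rewrite -hh.
by apply/hE; rewrite hh.
Qed.

Lemma xspan_l u v : xspan u v (xpos u).
Proof. by rewrite /xspan lexx /=; case: (leP (xpos u) (xpos v)) => //= /ltW ->. Qed.

Lemma xspan_r u v : xspan u v (xpos v).
Proof. by rewrite xspanC xspan_l. Qed.

Lemma pos_trace u v : u != v -> trace (edge_arc D (u, v)) (pos D u).
Proof.
move=> uv; exists 0; last by rewrite edge_start.
by rewrite /= in_itv /= lexx ler01.
Qed.

Lemma height_l u v : u != v -> height u v (xpos u) = ypos u.
Proof.
move=> uv; have [_ guv] := edge_graph uv.
by have [_] := (guv _).1 (pos_trace uv); rewrite -/(ypos u) => ->.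
Qed.

Lemma height_r u v : u != v -> height u v (xpos v) = ypos v.
Proof. by move=> uv; rewrite -height_rev // height_l // eq_sym. Qed.

Lemma trace_interior u v q : u != v -> trace (edge_arc D (u, v)) q ->
  q <> pos D u -> q <> pos D v -> arc_interior (edge_arc D (u, v)) q.
Proof.
move=> uv [t t01 <-] qu qv; exists t => //.
move: t01; rewrite /= !in_itv /= => /andP[t0 t1].
rewrite !lt_neqAle t0 t1 !andbT; apply/andP; split.
  by apply/eqP => e; apply: qu; rewrite -e edge_start.
by apply/eqP => e; apply: qv; rewrite e edge_end.
Qed.

(** Edges avoid the other vertices, so a further common point would be interior to both edges, hence
    a crossing of adjacent edges, as touchings are excluded. *)
Lemma star_disjoint u v w q : u != v -> u != w -> v != w ->
  trace (edge_arc D (u, v)) q -> trace (edge_arc D (u, w)) q -> q = pos D u.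
Proof.
move=> uv uw vw tv tw; apply: contrapT => qu.
have qv : q <> pos D v.
  by move=> e; apply: (@edge_avoid _ _ D (u, w) v) => //=; rewrite 1?eq_sym // -e.
have qw : q <> pos D w.
  by move=> e; apply: (@edge_avoid _ _ D (u, v) w) => //=; rewrite 1?eq_sym // -e.
apply: (hsemi uv uw vw (p := q)); apply: edge_no_touching => //.
- rewrite /distinct_edges /= !xpair_eqE !negb_and eqxx /= vw /=.
  by rewrite uw.
- exact: trace_interior.
- exact: trace_interior.
Qed.

Lemma height_neq u v w x : u != v -> u != w -> v != w -> xspan u v x -> xspan u w x ->
  x != xpos u -> height u v x != height u w x.
Proof.
move=> uv uw vw rv rw /eqP xu; apply/eqP => e; apply: xu.
have [_ tv] := edge_graph uv; have [_ tw] := edge_graph uw.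
have tvx : trace (edge_arc D (u, v)) (x, height u v x) by apply/tv.
have twx : trace (edge_arc D (u, w)) (x, height u v x) by apply/tw.
by rewrite /xpos -(star_disjoint uv uw vw tvx twx).
Qed.

Lemma xspan_between u v x1 x2 x : xspan u v x1 -> xspan u v x2 -> x1 <= x <= x2 -> xspan u v x.
Proof. by rewrite /xspan; lra. Qed.

(** A change of order on one side of [u] would, by the intermediate value theorem, give the two
    edges a common point other than [u]. *)
Lemma height_lt_const u v w x1 x2 : u != v -> u != w -> v != w ->
  xspan u v x1 -> xspan u w x1 -> xspan u v x2 -> xspan u w x2 ->
  (xpos u < x1 /\ xpos u < x2) \/ (x1 < xpos u /\ x2 < xpos u) ->
  height u v x1 < height u w x1 -> height u v x2 < height u w x2.
Proof.
move=> uv uw vw rv1 rw1 rv2 rw2 side lt1; rewrite ltNge; apply/negP => le2.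
pose f y := height u v y - height u w y.
have zero y1 y2 : y1 <= y2 -> xspan u v y1 -> xspan u w y1 -> xspan u v y2 -> xspan u w y2 ->
    (xpos u < y1 \/ y2 < xpos u) -> Num.min (f y1) (f y2) <= 0 <= Num.max (f y1) (f y2) -> False.
  move=> y12 h1 h2 h3 h4 sd mm.
  have [cv _] := edge_graph uv; have [cw _] := edge_graph uw.
  have cf : {within `[y1, y2], continuous f}.
    by move=> y; apply: cvgB; [exact: cv|exact: cw].
  have [y yy fy] := IVT y12 cf mm.
  rewrite in_itv /= in yy.
  have := @height_neq u v w y uv uw vw (xspan_between h1 h3 yy) (xspan_between h2 h4 yy).
  have -> : height u v y = height u w y by apply/eqP; rewrite -subr_eq0 -/(f y) fy.
  rewrite eqxx => ne; suff /ne : y != xpos u by [].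
  by case: sd => sd; [rewrite gt_eqF|rewrite lt_eqF] => //; lra.
have f1 : f x1 <= 0 by rewrite /f; lra.
have f2 : 0 <= f x2 by rewrite /f; lra.
case: (leP x1 x2) => x12.
  apply: (zero x1 x2) => //; first by case: side => -[]; [left|right].
  by rewrite ge_min le_max f1 f2 orbT.
apply: (zero x2 x1) => //; rewrite ?(ltW x12) //; first by case: side => -[]; [left|right].
by rewrite ge_min le_max f1 f2 orbT.
Qed.

(** The cut at parameter 2 separates the path through [v] from the edge between [w] and [u]; for
    sorted vertices these are the two graphs. *)
Lemma triangle_paths u v w : u != v -> u != w -> v != w ->
  [/\ {within `[0, 2], continuous (triangle D u v w)},
      {within `[2, 3], continuous (triangle D u v w)},
      triangle D u v w 0 = pos D u, triangle D u v w 2 = pos D w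
      & triangle D u v w 3 = pos D u] /\
  [/\ forall t, t \in `[0, 1] -> trace (edge_arc D (u, v)) (triangle D u v w t),
      forall t, t \in `[1, 2] -> trace (edge_arc D (v, w)) (triangle D u v w t) &
      forall t, t \in `[2, 3] -> trace (edge_arc D (u, w)) (triangle D u v w t)].
Proof.
move=> uv uw vw; have wu : w != u by rewrite eq_sym.
have arc1 (t : R) : t <= 1 -> triangle D u v w t = edge_arc D (u, v) t.
  by rewrite /triangle => ->.
have arc2 (t : R) : 1 <= t <= 2 -> triangle D u v w t = edge_arc D (v, w) (t - 1).
  rewrite /triangle => /andP[t1 t2]; rewrite t2; case: leP => // t1'.
  have -> : t = 1 by lra.
  by rewrite subrr edge_end // edge_start.
have arc3 (t : R) : 2 <= t -> triangle D u v w t = edge_arc D (w, u) (t - 2).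
  rewrite /triangle => t2; case: leP => t1; first by exfalso; lra.
  case: leP => // t2'; have -> : t = 2 by lra.
  have -> : 2 - 1 = 1 :> R by ring.
  by rewrite subrr edge_end // edge_start.
have shiftc (m : R) : continuous (fun t : R => t - m).
  by move=> t; apply: cvgB; [exact: cvg_id|exact: cvg_cst].
have c1 : {within `[0, 1], continuous (triangle D u v w)}.
  have [c _] := @edge_simple _ _ D (u, v) uv.
  by apply: subspace_eq_continuous c => t; rewrite inE /= in_itv /= => /andP[_ t1]; exact/esym/arc1.
have c2 : {within `[1, 2], continuous (triangle D u v w)}.
  have [c _] := @edge_simple _ _ D (v, w) vw.
  have {c} : {within `[1, 2], continuous (edge_arc D (v, w) \o (fun t => t - 1))}.
    by apply: within_continuous_precomp c (shiftc 1) _ => t; rewrite /= !in_itv /=; lra.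
  by apply: subspace_eq_continuous => t; rewrite inE /= in_itv /= => t12; exact/esym/arc2.
have c3 : {within `[2, 3], continuous (triangle D u v w)}.
  have [c _] := @edge_simple _ _ D (w, u) wu.
  have {c} : {within `[2, 3], continuous (edge_arc D (w, u) \o (fun t => t - 2))}.
    by apply: within_continuous_precomp c (shiftc 2) _ => t; rewrite /= !in_itv /=; lra.
  by apply: subspace_eq_continuous => t; rewrite inE /= in_itv /= => /andP[t2 _]; exact/esym/arc3.
split; split.
- exact: within_continuous_cat c1 c2.
- exact: c3.
- by rewrite arc1 // edge_start.
- by rewrite arc3 // subrr edge_start.
- rewrite arc3; last by lra.
  have -> : 3 - 2 = 1 :> R by ring.
  by rewrite edge_end.
- by move=> t t01; exists t => //; rewrite arc1 //; move: t01; rewrite in_itv /=; lra.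
- move=> t; rewrite in_itv /= => t12; exists (t - 1); last by rewrite arc2.
  by rewrite /= in_itv /=; lra.
- move=> t; rewrite in_itv /= => t23; rewrite -trace_rev //; exists (t - 2).
    by rewrite /= in_itv /=; lra.
  by rewrite arc3 //; lra.
Qed.

Lemma ccw_cyc u v w : u != v -> u != w -> v != w -> ccw D u v w -> ccw D v w u.
Proof.
move=> uv uw vw [p wn]; exists p.
have [[_ _ _ _ t3] _] := triangle_paths uv uw vw.
have wu : w != u by rewrite eq_sym.
apply: (@winding_number_shift _ _ _ 1 3 p 1 _ _ _ _ wn) => //; rewrite ?ler01 ?ltr1n //.
  have -> : 3 - 1 = 2 :> R by ring.
  move=> t; rewrite in_itv /= => /andP[t0 t2]; rewrite /triangle.
  have -> : (t + 1 <= 1) = (t <= 0) by apply/idP/idP; lra.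
  have -> : (t + 1 <= 2) = (t <= 1) by apply/idP/idP; lra.
  rewrite t2; have -> : t + 1 - 2 = t - 1 by ring.
  case: (leP t 0) => t0'.
    have -> : t = 0 by lra.
    by rewrite ler01 add0r edge_start // edge_end.
  case: (leP t 1) => // t1.
  by have -> : t + 1 - 1 = t by ring.
have -> : 3 - 1 = 2 :> R by ring.
move=> t; rewrite in_itv /= => /andP[t2 t3']; rewrite /triangle.
have -> : (t <= 1) = false by apply/negbTE; rewrite -ltNge; lra.
have -> : (t - 2 <= 1) by lra.
case: leP => // t2'; have -> : t = 2 by lra.
have -> : 2 - 1 = 1 :> R by ring.
by rewrite subrr edge_start // edge_end.
Qed.

(** Exchanging [v] and [w] traverses the same closed curve backwards, by [t] to [3 - t]. *)
Lemma ccw_rev u v w : u != v -> u != w -> v != w ->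
  ccw D u w v <-> exists p, winding_number (triangle D u v w) 0 3 p (-1).
Proof.
have rev a b c (t : R) : a != b -> a != c -> b != c -> t \in `[0, 3] ->
    triangle D a c b t = triangle D a b c (3 - t).
  move=> ab ac bc; rewrite in_itv /= => /andP[t0 t3].
  have [ba ca cb] : [/\ b != a, c != a & c != b] by split; rewrite eq_sym.
  rewrite /triangle.
  case: (leP t 1) => t1; case: (leP (3 - t) 1) => s1; try by exfalso; lra.
  - case: (leP (3 - t) 2) => s2.
      have -> : t = 1 by lra.
      have -> : 3 - 1 - 1 = 1 :> R by ring.
      by rewrite !edge_end.
    rewrite (@edge_rev _ _ D c a) ?in_itv /= ?t0 //; congr edge_arc; ring.
  - case: (leP t 2) => t2.
      have -> : t = 2 by lra.
      have -> : 3 - 2 = 1 :> R by ring.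
      have -> : 2 - 1 = 1 :> R by ring.
      by rewrite !edge_end.
    rewrite (@edge_rev _ _ D a b) //; last by rewrite in_itv /=; lra.
    by congr edge_arc; ring.
  - case: (leP t 2) => t2; last by exfalso; lra.
    case: (leP (3 - t) 2) => s2; last by exfalso; lra.
    rewrite (@edge_rev _ _ D b c) //; last by rewrite in_itv /=; lra.
    by congr edge_arc; ring.
move=> uv uw vw; split=> -[p wn]; exists p.
  apply: (winding_number_reverse _ wn) => t t03; apply: rev => //.
  by rewrite eq_sym.
have hE (t : R) : t \in `[0, 3] -> triangle D u w v t = triangle D u v w (3 - t).
  exact: rev.
by have := winding_number_reverse hE wn; rewrite opprK.
Qed.

(** The path through [v] is the graph of a function [F]. Its position relative to the edge [uw] at
    [v] persists over the whole open interval: left of [v] two edges at [u] are compared, right of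
    [v] two edges at [w], and neither pair changes order. *)
Lemma ccw_sorted u v w : xpos u < xpos v -> xpos v < xpos w ->
  (ypos v < height u w (xpos v) -> ccw D u v w /\ ~ ccw D u w v) /\
  (height u w (xpos v) < ypos v -> ~ ccw D u v w /\ ccw D u w v).
Proof.
move=> xuv xvw; have xuw := lt_trans xuv xvw.
have uv : u != v by apply: contraTneq xuv => ->; rewrite ltxx.
have uw : u != w by apply: contraTneq xuw => ->; rewrite ltxx.
have vw : v != w by apply: contraTneq xvw => ->; rewrite ltxx.
have [wu wv vu] : [/\ w != u, w != v & v != u] by split; rewrite eq_sym.
have [[c1 c2 t0 t2 t3] [tr1 tr2 tr3]] := triangle_paths uv uw vw.
pose F x := if x <= xpos v then height u v x else height v w x.
have [_ guv] := edge_graph uv; have [_ gvw] := edge_graph vw; have [_ guw] := edge_graph uw.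
have h02 : 0 < 2 :> R by lra.
have h23 : 2 < 3 :> R by lra.
have g03 : triangle D u v w 0 = triangle D u v w 3 by rewrite t0 t3.
have gF t : t \in `[0, 2] -> (triangle D u v w t).1 \in `[xpos u, xpos w] /\
    (triangle D u v w t).2 = F (triangle D u v w t).1.
  rewrite !in_itv /= => /andP[t0' t2']; case: (leP t 1) => t1.
    have [|r e] := (guv _).1 (tr1 t _); first by rewrite in_itv /= t0'.
    rewrite /F; move: r; rewrite /xspan => r.
    have -> : (triangle D u v w t).1 <= xpos v by lra.
    by split=> //; lra.
  have [|r e] := (gvw _).1 (tr2 t _); first by rewrite in_itv /= (ltW t1).
  move: r; rewrite /xspan => r; split; first by lra.
  rewrite /F; case: leP => // le; have xe : (triangle D u v w t).1 = xpos v by lra.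
  by rewrite e xe height_l // height_r.
have gG t : t \in `[2, 3] -> (triangle D u v w t).1 \in `[xpos u, xpos w] /\
    (triangle D u v w t).2 = height u w (triangle D u v w t).1.
  move=> t23; have [r e] := (guw _).1 (tr3 t t23); split => //.
  by move: r; rewrite /xspan in_itv /=; lra.
have rv1 : xspan u w (xpos v) by rewrite /xspan; lra.
split=> lt; rewrite (ccw_rev uv uw vw).
  apply: (two_graphs_ccw h02 h23 xuw c1 c2 g03 _ _ gF gG); rewrite ?t0 ?t2 //.
  move=> x; rewrite in_itv /= => /andP[x1 x2]; rewrite /F; case: (leP x (xpos v)) => xv.
    apply: (@height_lt_const u v w (xpos v) x) => //; rewrite ?xspan_r // /xspan ?height_r //.
    - by lra.
    - by lra.
    - by left.
  rewrite (height_rev wv) (height_rev wu).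
  apply: (@height_lt_const w v u (xpos v) x) => //; rewrite ?xspan_r // /xspan.
  - by lra.
  - by lra.
  - by lra.
  - by right.
  - by rewrite height_r // -(height_rev wu).
apply/and_comm; apply: (two_graphs_cw h02 h23 xuw c1 c2 g03 _ _ gF gG); rewrite ?t0 ?t2 //.
move=> x; rewrite in_itv /= => /andP[x1 x2]; rewrite /F; case: (leP x (xpos v)) => xv.
  apply: (@height_lt_const u w v (xpos v) x) => //; rewrite ?xspan_r // /xspan ?height_r //.
  - by lra.
  - by lra.
  - by left.
rewrite (height_rev wv) (height_rev wu).
apply: (@height_lt_const w u v (xpos v) x) => //; rewrite ?xspan_r // /xspan.
- by lra.
- by lra.
- by lra.
- by right.
- by rewrite height_r // -(height_rev wu).
Qed.

End MonotoneDrawing.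

(** * Orientations as orders of the edges at a vertex *)

Section Orientation.
Context {R : realType} {n : nat} (D : drawing R n).
Hypotheses (hmono : x_monotone D) (hsemi : semisimple D).
Implicit Types (u v w : 'I_n) (x : R).
Local Notation X := (xpos D).
Local Notation Y := (ypos D).
Local Notation H := (height D).

Definition orient u v w : bool := `[< ccw D u v w >].

Lemma orient_cyc u v w : u != v -> u != w -> v != w -> orient u v w = orient v w u.
Proof.
move=> uv uw vw; apply/asbool_equiv_eq; split; first exact: ccw_cyc.
have [wu wv vu] : [/\ w != u, w != v & v != u] by split; rewrite eq_sym.
by move=> /(ccw_cyc vw vu wu) /(ccw_cyc wu wv uv).
Qed.

Lemma lt_xpos_neq u v : X u < X v -> u != v.
Proof. by apply: contraTneq => ->; rewrite ltxx. Qed.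

(** Writing [H u v (X v)] for [Y v] makes these comparisons of two edges at [u], which can be moved
    to other abscissas. *)
Lemma orient_sorted u v w : X u < X v -> X v < X w ->
  orient u v w = (H u v (X v) < H u w (X v)) /\
  orient u w v = (H u w (X v) < H u v (X v)).
Proof.
move=> xuv xvw; have [below above] := ccw_sorted hmono hsemi xuv xvw.
have uv := lt_xpos_neq xuv; have vw := lt_xpos_neq xvw.
have uw := lt_xpos_neq (lt_trans xuv xvw).
have Yv := height_r hmono uv.
have : H u v (X v) != H u w (X v).
  apply: (height_neq hmono hsemi) => //; rewrite ?xspan_r ?gt_eqF //.
  by rewrite /xspan (ltW xuv) (ltW xvw).
rewrite Yv /orient; case: (ltgtP (Y v)) => // [/below|/above] [h1 h2] _.
  by split; [rewrite asboolT|rewrite asboolF].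
by split; [rewrite asboolF|rewrite asboolT].
Qed.

Lemma height_lt_constE u v w x1 x2 : u != v -> u != w -> v != w ->
  xspan D u v x1 -> xspan D u w x1 -> xspan D u v x2 -> xspan D u w x2 ->
  (X u < x1 /\ X u < x2) \/ (x1 < X u /\ x2 < X u) ->
  (H u v x1 < H u w x1) = (H u v x2 < H u w x2).
Proof.
move=> uv uw vw rv1 rw1 rv2 rw2 side; apply/idP/idP.
  exact: (height_lt_const hmono hsemi).
apply: (height_lt_const hmono hsemi) => //.
by case: side => -[]; [left|right].
Qed.

(** At the abscissa of the nearer of [v] and [w] this is [orient_sorted], and the two edges at [u]
    keep their order from there to [x]. *)
Lemma orient_right u v w x : v != w -> X u < x -> x <= X v -> x <= X w ->
  orient u v w = (H u v x < H u w x).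
Proof.
move=> vw ux xv xw.
have uv := lt_xpos_neq (lt_le_trans ux xv); have uw := lt_xpos_neq (lt_le_trans ux xw).
have rv : xspan D u v x by rewrite /xspan (ltW ux) xv.
have rw : xspan D u w x by rewrite /xspan (ltW ux) xw.
case: (ltgtP (X v) (X w)) => [lt|lt|/(xpos_inj hmono) e]; last by rewrite e eqxx in vw.
  rewrite (orient_sorted (lt_le_trans ux xv) lt).1.
  apply: height_lt_constE => //; rewrite ?xspan_r //; last by left; split=> //; exact: lt_le_trans xv.
  by rewrite /xspan (ltW (lt_le_trans ux xv)) (ltW lt).
rewrite (orient_sorted (lt_le_trans ux xw) lt).2.
apply: height_lt_constE => //; rewrite ?xspan_r //; last by left; split=> //; exact: lt_le_trans xw.
by rewrite /xspan (ltW (lt_le_trans ux xw)) (ltW lt).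
Qed.

(** Here the order is reversed: rotated to begin with its leftmost vertex, the triple compares its
    middle vertex with the edge from the leftmost vertex to [u]. *)
Lemma orient_left u v w x : v != w -> x < X u -> X v <= x -> X w <= x ->
  orient u v w = (H u w x < H u v x).
Proof.
move=> vw xu vx wx.
have vu := lt_xpos_neq (le_lt_trans vx xu); have wu := lt_xpos_neq (le_lt_trans wx xu).
have [uv uw wv] : [/\ u != v, u != w & w != v] by split; rewrite eq_sym.
have rv : xspan D u v x by rewrite /xspan vx (ltW xu) orbT.
have rw : xspan D u w x by rewrite /xspan wx (ltW xu) orbT.
rewrite orient_cyc //.
case: (ltgtP (X v) (X w)) => [lt|lt|/(xpos_inj hmono) e]; last by rewrite e eqxx in vw.
  rewrite (orient_sorted lt (le_lt_trans wx xu)).1 (height_r hmono vw).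
  rewrite -(height_r hmono uw) (height_rev D uv).
  apply: height_lt_constE => //; rewrite ?xspan_r //; last by right; split=> //; exact: le_lt_trans xu.
  by rewrite /xspan (ltW lt) (ltW (le_lt_trans wx xu)) orbT.
rewrite orient_cyc // (orient_sorted lt (le_lt_trans vx xu)).2 (height_r hmono wv).
rewrite -(height_r hmono uv) (height_rev D uw).
apply: height_lt_constE => //; rewrite ?xspan_r //; last by right; split=> //; exact: le_lt_trans xu.
by rewrite /xspan (ltW lt) (ltW (le_lt_trans vx xu)) orbT.
Qed.

(** With the leftmost vertex first, both orientations compare the same two heights, which differ by
    [height_neq]; the other cases are rotations of this one. *)
Lemma orient_anti u v w : u != v -> u != w -> v != w -> orient u w v = ~~ orient u v w.
Proof.
have anti_min a b c : b != c -> X a < X b -> X a < X c -> orient a c b = ~~ orient a b c.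
  move=> bc ab ac; have cb : c != b by rewrite eq_sym.
  pose x := Num.min (X b) (X c).
  have [ax xb xc] : [/\ X a < x, x <= X b & x <= X c].
    by rewrite /x lt_min ab ac !ge_min !lexx orbT.
  rewrite (orient_right cb ax xc xb) (orient_right bc ax xb xc).
  have nab := lt_xpos_neq ab; have nac := lt_xpos_neq ac.
  rewrite -leNgt lt_neqAle eq_sym (height_neq hmono hsemi) // /xspan.
  - by rewrite (ltW ax) xb.
  - by rewrite (ltW ax) xc.
  - by rewrite gt_eqF.
move=> uv uw vw; have [vu wu wv] : [/\ v != u, w != u & w != v] by split; rewrite eq_sym.
have neq a b : a != b -> X a <= X b -> X a < X b.
  by move=> ab le; rewrite lt_neqAle xpos_neq.
case: (leP (X u) (X v)) => [/(neq _ _ uv)|] xuv.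
  case: (leP (X u) (X w)) => [/(neq _ _ uw)|] xuw; first exact: anti_min.
  have xwv := lt_trans xuw xuv.
  by rewrite (orient_cyc uw uv wv) (orient_cyc uv uw vw) (orient_cyc vw vu wu) anti_min.
case: (leP (X v) (X w)) => [/(neq _ _ vw)|] xvw.
  by rewrite (orient_cyc uw uv wv) (orient_cyc wv wu vu) (orient_cyc uv uw vw) anti_min // eq_sym.
have xwu := lt_trans xvw xuv.
by rewrite (orient_cyc uw uv wv) (orient_cyc uv uw vw) (orient_cyc vw vu wu) anti_min.
Qed.

Lemma orient_tournament_right u :
  transitive_tournament (orient u) [set v | (X u < X v)%O]%SET.
Proof.
split=> [v w|v w t]; rewrite !finset.in_set => uv uw.
  by move=> vw; rewrite (orient_anti (lt_xpos_neq uw) (lt_xpos_neq uv)) // eq_sym.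
(* All three edges at [u] have a point over this [x], so transitivity is that of their heights. *)
move=> ut vw wt vt; pose x := Num.min (X v) (Num.min (X w) (X t)).
have [ux xv xw xt] : [/\ X u < x, x <= X v, x <= X w & x <= X t].
  by rewrite /x !lt_min uv uw ut !ge_min !lexx !orbT.
rewrite (orient_right vw ux) // (orient_right wt ux) // (orient_right vt ux) //.
exact: lt_trans.
Qed.

Lemma orient_tournament_left u :
  transitive_tournament (orient u) [set v | (X v < X u)%O]%SET.
Proof.
split=> [v w|v w t]; rewrite !finset.in_set => vu wu.
  move=> vw; have [nvu nwu] := (lt_xpos_neq vu, lt_xpos_neq wu).
  by rewrite (@orient_anti u w v) // eq_sym.
move=> tu vw wt vt; pose x := Num.max (X v) (Num.max (X w) (X t)).
have [ux xv xw xt] : [/\ x < X u, X v <= x, X w <= x & X t <= x].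
  by rewrite /x !gt_max vu wu tu !le_max !lexx !orbT.
rewrite (orient_left vw ux) // (orient_left wt ux) // (orient_left vt ux) //.
by move=> h1 h2; exact: lt_trans h2 h1.
Qed.

Lemma min_sideE K u v : (K - min_side D u v)%N = weight orient [set: 'I_n]%SET K u v.
Proof.
congr (_ - minn _ _)%N; apply: eq_card => w; by rewrite !inE.
Qed.

(** Reversing an edge exchanges its two sides. *)
Lemma weight_sym K u v : u != v ->
  weight orient [set: 'I_n]%SET K u v = weight orient [set: 'I_n]%SET K v u.
Proof.
move=> uv; have vu : v != u by rewrite eq_sym.
rewrite /weight minnC; congr (_ - minn _ _)%N; apply: eq_card => w; rewrite !inE /=;
  case: (eqVneq w u) => [|wu]; rewrite ?andbF //; case: (eqVneq w v) => [|wv]; rewrite ?andbF //=.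
  have [uw vw] : u != w /\ v != w by split; rewrite eq_sym.
  by rewrite (orient_cyc vu vw uw) (orient_anti uv uw vw).
have [uw vw] : u != w /\ v != w by split; rewrite eq_sym.
by rewrite (orient_cyc vu vw uw) (orient_anti uv uw vw) negbK.
Qed.

End Orientation.

(** * Edge counts as sums over edges *)

Lemma sum_eq_leq (m j : nat) : (\sum_(i < j.+1) (m == i :> nat : nat) = (m <= j : nat))%N.
Proof.
elim: j => [|j IH]; first by rewrite big_ord1; case: m.
by rewrite big_ord_recr /= IH; lia.
Qed.

Lemma sum_leq (m k : nat) : (\sum_(j < k.+1) (m <= j : nat) = k.+1 - m)%N.
Proof.
elim: k => [|k IH]; first by rewrite big_ord1; case: m.
by rewrite big_ord_recr /= IH; lia.
Qed.

(** An edge with [min_side] equal to [m] is counted in [E_le D j] for each [j] from [m] to [k], thus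
    [k.+1 - m] times. *)
Lemma E_leleE (R : realType) (n : nat) (D : drawing R n) (k : nat) :
  E_lele D k = (\sum_(e : 'I_n * 'I_n | (e.1 < e.2)%N) (k.+1 - min_side D e.1 e.2))%N.
Proof.
have E_eqE i : E_eq D i =
    (\sum_(e : 'I_n * 'I_n | (e.1 < e.2)%N) (min_side D e.1 e.2 == i))%N.
  rewrite /E_eq -sum1_card (eq_bigl (fun e : 'I_n * 'I_n =>
    (e.1 < e.2)%N && (min_side D e.1 e.2 == i))); last by move=> e; rewrite inE.
  by rewrite big_mkcondr; apply: eq_bigr => e _; case: eqP.
rewrite /E_lele /E_le (eq_bigr (fun j : 'I_k.+1 =>
    \sum_(e : 'I_n * 'I_n | (e.1 < e.2)%N) (min_side D e.1 e.2 <= j : nat))%N).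
  rewrite exchange_big /=; apply: eq_bigr => e _.
  exact: sum_leq.
move=> j _; under eq_bigr => i _ do rewrite E_eqE; rewrite exchange_big /=.
by apply: eq_bigr => e _; rewrite sum_eq_leq.
Qed.

(** The right side does not mention [r], so the order of labels, used to count edges, can be
    replaced by the order of abscissas, used in [total_weight]. *)
Lemma sum_total_order (I : finType) (r : rel I) (F : I -> I -> nat) :
  (forall u v, u != v -> r u v = ~~ r v u) -> (forall u, ~~ r u u) ->
  (forall u v, u != v -> F u v = F v u) ->
  ((\sum_(p | r p.1 p.2) F p.1 p.2).*2 = \sum_(p | p.1 != p.2) F p.1 p.2)%N.
Proof.
move=> tot irr sym; rewrite [RHS](bigID (fun p => r p.1 p.2)) /= -addnn.
have ne u v : r u v -> u != v by apply: contraTneq => ->.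
congr addn; first by apply: eq_bigl => -[u v] /=; case: (boolP (r u v)) => [/ne ->|]; rewrite ?andbF.
rewrite (reindex_inj (can_inj (@swap_pairK _ _))) /=.
have gt_ne u v : r v u = (u != v) && ~~ r u v.
  case: (eqVneq u v) => [->|uv] /=; first exact/negbTE/irr.
  by rewrite tot // eq_sym.
apply: eq_big => [[u v]|[u v]] /=; first exact: gt_ne.
by rewrite gt_ne => /andP[uv _]; rewrite sym // eq_sym.
Qed.

Theorem theorem2 (R : realType) (n : nat) (hn : (3 <= n)%N)
    (D : drawing R n) (hmono : x_monotone D) (hsemi : semisimple D)
    (k : nat) (hk : k%:R < n%:R / 2 - 1 :> R) :
  (3 * 'C(k + 3, 3) <= E_lele D k)%N.
Proof.
pose W u v := weight (orient D) [set: 'I_n]%SET k.+1 u v.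
have symW u v : u != v -> W u v = W v u by exact: weight_sym.
have kn : (k.+1.*2 < n)%N.
  by rewrite -(ltr_nat R) -muln2 natrM -natr1; lra.
have -> : E_lele D k = total_weight (xpos D) (orient D) [set: 'I_n]%SET k.+1.
  rewrite E_leleE (eq_bigr (fun e => W e.1 e.2)); last by move=> e _; rewrite min_sideE.
  rewrite /total_weight pair_big_dep /=; apply: double_inj.
  rewrite (sum_total_order (r := fun u v : 'I_n => (u < v)%N)) //; last 2 first.
  - by move=> u v uv; rewrite -leqNgt ltn_neqAle uv.
  - by move=> u; rewrite ltnn.
  rewrite (eq_bigl (fun p : 'I_n * 'I_n => xpos D p.1 < xpos D p.2)); last first.
    by move=> p; rewrite !inE.
  rewrite (sum_total_order (r := fun u v => xpos D u < xpos D v) (F := W)) //.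
  - by move=> u v uv; rewrite -leNgt lt_neqAle xpos_neq.
  - by move=> u; rewrite ltxx.
rewrite addn3; apply: total_weight_ge.
- exact: xpos_inj.
- exact: orient_cyc.
- exact: (orient_tournament_right hmono hsemi).
- exact: (orient_tournament_left hmono hsemi).
- by rewrite cardsT card_ord.
Qed.
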